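(* Consider the following thirteen cubic forms in $\mathrm{Sym}_3(\mathbb{C}^4)=\mathbb{C}[x_1,x_2,x_3,x_4]_3$: - 1A: $x_1^3$ - 2A: $x_1^3+x_2^3$ - 3A: $x_1^2x_2$ - 4A: $x_2^2x_3-x_1^3-x_1^2x_3$ - 4B: $x_2^2x_3-x_1^3$ - 4C: $x_1(x_1^2+x_2x_3)$ - 4D: $x_1x_2x_3$ - 5A: $x_2(x_1^2+x_2x_3)$ - 6A: $x_1(x_1^2+x_2^2+x_3^2+x_4^2)$ - 6B: $x_1(x_2^2+x_3^2+x_4^2)$ - 6C: $x_1x_2^2+x_3x_4^2$ - 7A: $x_1(x_1x_2+x_3^2+x_4^2)$ - 7B: $x_1^2x_2+x_1x_3x_4+x_3^3$ For labels $R,C$ write $R\preceq C$ if the orbit closure of the cubic surface $R$ under $PGL(4,\mathbb{C})$ is contained in the orbit closure of the cubic surface $C$. Then $R\preceq R$ for every label $R$, and for $R\neq C$ the following hold. (a) (Containments.) - $1A\preceq C$ for every label $C$. - $2A\preceq C$ for every $C\in\{4A,4B,4C,4D,5A,6A,6B,6C,7A,7B\}$. - $3A\preceq C$ for every $C\in\{2A,4A,4B,4C,4D,5A,6A,6B,6C,7A,7B\}$. - $4A\preceq 6C$. - $4B\preceq C$ for every $C\in\{4A,6C,7B\}$. - $4C\preceq C$ for every $C\in\{4A,6A,6B,6C,7A,7B\}$. - $4D\preceq C$ for every $C\in\{4A,4C,6A,6B,6C,7A,7B\}$. - $5A\preceq C$ for every $C\in\{4A,4B,4C,6A,6B,6C,7A,7B\}$.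 - $6B\preceq 6A$. - $7A\preceq 6A$. - $7B\preceq 6C$. (b) (Non-containments.) - $2A\not\preceq C$ for $C\in\{1A,3A\}$. - $3A\not\preceq 1A$. - $4A\not\preceq C$ for $C\in\{1A,2A,3A,4B,4C,4D,5A,6B,7A\}$. - $4B\not\preceq C$ for $C\in\{1A,2A,3A,4C,4D,5A\}$. - $4C\not\preceq C$ for $C\in\{1A,2A,3A,4B,4D,5A\}$. - $4D\not\preceq C$ for $C\in\{1A,2A,3A,5A\}$. - $5A\not\preceq C$ for $C\in\{1A,2A,3A,4D\}$. - $6A\not\preceq C$ for $C\in\{1A,2A,3A,4A,4B,4C,4D,5A,6B,7A,7B\}$. - $6B\not\preceq C$ for $C\in\{1A,2A,3A,4A,4B,4C,4D,5A,7A\}$. - $6C\not\preceq C$ for every label $C\neq 6C$. - $7A\not\preceq C$ for $C\in\{1A,2A,3A,4A,4B,4C,4D,5A,6B\}$. - $7B\not\preceq C$ for $C\in\{1A,2A,3A,4A,4B,4C,4D,5A,6A,6B,7A\}$.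
   Context: A cubic surface is given by a nonzero homogeneous polynomial $v$ of degree $3$ in $x_1,x_2,x_3,x_4$ with complex coefficients, considered up to a nonzero scalar, i.e. a point of $\mathbb{P}(\mathrm{Sym}_3(\mathbb{C}^4))$. The group $PGL(4,\mathbb{C})$ acts by linear change of coordinates, $g\cdot v=v\circ g$. The orbit closure of $v$ is the Zariski closure of its orbit (over $\mathbb{C}$ this coincides with the Euclidean closure). Equivalently, one may use $GL(4,\mathbb{C})$ acting on the vector space $\mathrm{Sym}_3(\mathbb{C}^4)$ by $g\cdot v=v\circ g$ and Zariski closures of orbits in that vector space. *)

(* Defs.v *)
From HB Require Import structures.
From mathcomp Require Import all_boot all_order all_algebra.
From mathcomp Require Import complex reals.
From mathcomp Require Import mpoly.

Set Implicit Arguments.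
Unset Strict Implicit.
Unset Printing Implicit Defensive.

Import GRing.Theory.
Local Open Scope ring_scope.

(* For [R : realType], the field C is [R[i]]. A point of P(Sym_3(C^4)) is
   given by its representatives, the nonzero cubic forms in four variables,
   and a subset of P(Sym_3(C^4)) by the set of representatives of its points. *)
Definition is_cubic (R : realType) (v : {mpoly R[i][4]}) : Prop :=
  v != 0 /\ v \is 3.-homog.

(* [linear_subst g v] is v o g, where g acts on column vectors. *)
Definition linear_subst (R : realType) (g : 'M[R[i]]_4) (v : {mpoly R[i][4]}) :
    {mpoly R[i][4]} :=
  v \mPo [tuple \sum_(j < 4) g i j *: 'X_j | i < 4].

(* All representatives of the points of the orbit of [v]; elements of
   PGL(4, C) are given by invertible matrices. *)
Definition pgl_orbit (R : realType) (v w : {mpoly R[i][4]}) : Prop :=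
  exists (g : 'M[R[i]]_4) (c : R[i]),
    [/\ g \in unitmx, c != 0 & w = c *: linear_subst g v].

(* The 20 monomials of degree exactly 3 in four variables. *)
Definition mon3 : finType := {m : 'X_{1..4 < 4} | mdeg m == 3}.

(* The homogeneous coordinates on P(Sym_3(C^4)). *)
Definition cubic_coord (R : realType) (v : {mpoly R[i][4]}) : 'I_#|mon3| -> R[i] :=
  fun k => v@_(val (enum_val k : mon3)).

Definition zariski_closed (R : realType) (Z : {mpoly R[i][4]} -> Prop) : Prop :=
  exists E : {mpoly R[i][#|mon3|]} -> Prop,
    (forall F, E F -> exists d : nat, F \is d.-homog) /\
    (forall w, Z w <-> is_cubic w /\ forall F, E F -> F.@[cubic_coord w] = 0).

Definition zariski_closure (R : realType) (S : {mpoly R[i][4]} -> Prop)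
    (w : {mpoly R[i][4]}) : Prop :=
  forall Z : {mpoly R[i][4]} -> Prop,
    zariski_closed Z -> (forall u, S u -> Z u) -> Z w.

Definition orbit_closure (R : realType) (v : {mpoly R[i][4]}) :
    {mpoly R[i][4]} -> Prop :=
  zariski_closure (pgl_orbit v).

Inductive label : Type :=
  | L1A | L2A | L3A | L4A | L4B | L4C | L4D
  | L5A | L6A | L6B | L6C | L7A | L7B.

Lemma label_comparable : comparable label.
Proof. by move=> a b; rewrite /decidable; decide equality. Defined.

HB.instance Definition _ := hasDecEq.Build label (compareP label_comparable).

Definition cubic (R : realType) (l : label) : {mpoly R[i][4]} :=
  let x1 : {mpoly R[i][4]} := 'X_(@Ordinal 4 0 isT) in
  let x2 : {mpoly R[i][4]} := 'X_(@Ordinal 4 1 isT) in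
  let x3 : {mpoly R[i][4]} := 'X_(@Ordinal 4 2 isT) in
  let x4 : {mpoly R[i][4]} := 'X_(@Ordinal 4 3 isT) in
  match l with
  | L1A => x1 ^+ 3
  | L2A => x1 ^+ 3 + x2 ^+ 3
  | L3A => x1 ^+ 2 * x2
  | L4A => x2 ^+ 2 * x3 - x1 ^+ 3 - x1 ^+ 2 * x3
  | L4B => x2 ^+ 2 * x3 - x1 ^+ 3
  | L4C => x1 * (x1 ^+ 2 + x2 * x3)
  | L4D => x1 * x2 * x3
  | L5A => x2 * (x1 ^+ 2 + x2 * x3)
  | L6A => x1 * (x1 ^+ 2 + x2 ^+ 2 + x3 ^+ 2 + x4 ^+ 2)
  | L6B => x1 * (x2 ^+ 2 + x3 ^+ 2 + x4 ^+ 2)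
  | L6C => x1 * x2 ^+ 2 + x3 * x4 ^+ 2
  | L7A => x1 * (x1 * x2 + x3 ^+ 2 + x4 ^+ 2)
  | L7B => x1 ^+ 2 * x2 + x1 * x3 * x4 + x3 ^+ 3
  end.

Definition degen (R : realType) (r c : label) : Prop :=
  forall w, orbit_closure (cubic R r) w -> orbit_closure (cubic R c) w.

(* Main.v *)
Require Import Defs.
From mathcomp Require Import all_boot all_order all_algebra.
From mathcomp Require Import perm.
From mathcomp Require Import complex reals.
From mathcomp Require Import mpoly.
From mathcomp Require Import ring.

Set Implicit Arguments.
Unset Strict Implicit.
Unset Printing Implicit Defensive.

Import GRing.Theory Num.Theory.
Local Open Scope ring_scope.

(** For [R <= C] we give matrices g(s), polynomial in s and invertible for s != 0, such
    that a scalar multiple of C o g(s) tends to R as s -> 0: a homogeneous equation of the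
    orbit of C vanishes on the curve for s != 0, hence at s = 0. Only the covering
    relations of the order need a curve.

    For a non-containment we exhibit a homogeneous polynomial P in the coefficients that
    vanishes on the orbit of C but not at R. Every P is written in terms of the symmetric
    trilinear form of a cubic v (its third polar), for which v o g amounts to moving the
    arguments by g:
    - the rank of the first partial derivatives separates forms in different numbers of
      variables;
    - the discriminant on a line, and the Hessian determinant of binary cubics, separate
      1A, 3A and 2A;
    - let H be the Hessian determinant of the restriction to a hyperplane. H is proportional
      to v for 4D, but not for 5A; it is l m^2 for 4B (so that its discriminant on a line
      vanishes), but not for 4D; it shares a linear factor with v for 6A (so that the
      resultant on a line vanishes), but not for 4B;
    - the full Hessian determinant is a fourth power for 7A and 7B, but not for 6B and 6C;
      it is v times a linear form for 6B, but not for 7A.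
    All other non-containments follow from these by transitivity. *)

(** * Homogeneous polynomial functions of the coefficients of a cubic *)

Definition form_fun (R : realType) (d : nat) (P : {mpoly R[i][4]} -> R[i]) : Prop :=
  exists2 F : {mpoly R[i][#|mon3|]},
    F \is d.-homog & forall w, P w = F.@[cubic_coord w].

Section FormFun.
Variable R : realType.
Implicit Types (P Q : {mpoly R[i][4]} -> R[i]).

Lemma form_fun_coef (m : 'X_{1..4}) :
  mdeg m = 3%N -> form_fun 1 (fun w : {mpoly R[i][4]} => w@_m).
Proof.
move=> dm; have lt4 : (mdeg m < 4)%N by rewrite dm.
have dm' : mdeg (BMultinom lt4) == 3 by rewrite /= dm.
exists 'X_(enum_rank (exist _ (BMultinom lt4) dm' : mon3)); last first.
  by move=> w; rewrite mevalXU /cubic_coord enum_rankK.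
by rewrite dhomogX; apply/eqP/mdeg1.
Qed.

Lemma form_fun0 d : form_fun d (fun=> 0 : R[i]).
Proof. by exists 0 => [|w]; rewrite ?dhomog0 ?meval0. Qed.

Lemma form_fun1 : form_fun 0 (fun=> 1 : R[i]).
Proof. by exists 1 => [|w]; rewrite ?dhomog1 ?meval1. Qed.

Lemma form_funD d P Q :
  form_fun d P -> form_fun d Q -> form_fun d (fun w => P w + Q w).
Proof.
move=> [F hF eF] [G hG eG]; exists (F + G); first exact: dhomogD.
by move=> w; rewrite mevalD eF eG.
Qed.

Lemma form_funZ d c P : form_fun d P -> form_fun d (fun w => c * P w).
Proof.
move=> [F hF eF]; exists (c *: F); first exact: dhomogZ.
by move=> w; rewrite mevalZ eF.
Qed.

Lemma form_funB d P Q :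
  form_fun d P -> form_fun d Q -> form_fun d (fun w => P w - Q w).
Proof.
move=> [F hF eF] [G hG eG]; exists (F - G); first by rewrite rpredB.
by move=> w; rewrite mevalB eF eG.
Qed.

Lemma form_funM d e P Q :
  form_fun d P -> form_fun e Q -> form_fun (d + e) (fun w => P w * Q w).
Proof.
move=> [F hF eF] [G hG eG]; exists (F * G); first exact: dhomogM.
by move=> w; rewrite mevalM eF eG.
Qed.

Lemma form_fun_sum (I : Type) (r : seq I) d (F : I -> {mpoly R[i][4]} -> R[i]) :
  (forall i, form_fun d (F i)) -> form_fun d (fun w => \sum_(i <- r) F i w).
Proof.
move=> h; elim: r => [|i r [G hG eG]].
  by case: (form_fun0 d) => G hG eG; exists G => // w; rewrite big_nil (eG w).
have [H hH eH] := form_funD (h i) (ex_intro2 _ _ G hG eG).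
by exists H => // w; rewrite big_cons eH.
Qed.

Lemma form_fun_prod (I : Type) (r : seq I) (F : I -> {mpoly R[i][4]} -> R[i]) :
  (forall i, form_fun 1 (F i)) -> form_fun (size r) (fun w => \prod_(i <- r) F i w).
Proof.
move=> h; elim: r => [|i r [G hG eG]].
  by case: form_fun1 => G hG eG; exists G => // w; rewrite big_nil (eG w).
have [H hH eH] := form_funM (h i) (ex_intro2 _ _ G hG eG).
by exists H => // w; rewrite big_cons eH.
Qed.

Lemma form_fun_det n (M : {mpoly R[i][4]} -> 'M[R[i]]_n) :
  (forall i j, form_fun 1 (fun w => M w i j)) -> form_fun n (fun w => \det (M w)).
Proof.
move=> h; rewrite /determinant; apply: form_fun_sum => s; apply: form_funZ.
have := form_fun_prod (index_enum 'I_n) (fun i => h i ((s : {perm _}) i)).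
by rewrite -[index_enum _]enumT size_enum_ord.
Qed.

End FormFun.

(** * Polars of cubic forms *)

Definition dirder (R : realType) (a : 'cV[R[i]]_4) (w : {mpoly R[i][4]}) :=
  \sum_k a k 0 *: w^`M(k).

(* Six times the symmetric trilinear form attached to the cubic form [w]. *)
Definition polar (R : realType) (w : {mpoly R[i][4]}) (a b c : 'cV[R[i]]_4) : R[i] :=
  (dirder c (dirder b (dirder a w)))@_0.

(** The coefficients form a row, so that [u *m a] is the value at [a] and a substitution multiplies
    [u] by a matrix on the right. *)
Definition linf (R : realType) (u : 'rV[R[i]]_4) : {mpoly R[i][4]} :=
  \sum_k u 0 k *: 'X_k.

Section Polar.
Variable R : realType.
Implicit Types (v w : {mpoly R[i][4]}) (a b c : 'cV[R[i]]_4) (g h : 'M[R[i]]_4)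
  (u : 'rV[R[i]]_4).

Lemma dirderD a v w : dirder a (v + w) = dirder a v + dirder a w.
Proof. by rewrite -big_split; apply: eq_bigr => k _; rewrite mderivD scalerDr. Qed.

Lemma dirderZ a (x : R[i]) w : dirder a (x *: w) = x *: dirder a w.
Proof.
rewrite /dirder scaler_sumr; apply: eq_bigr => k _.
by rewrite mderivZ !scalerA mulrC.
Qed.

Lemma dirderM a v w : dirder a (v * w) = dirder a v * w + v * dirder a w.
Proof.
rewrite /dirder mulr_suml mulr_sumr -big_split; apply: eq_bigr => k _ /=.
by rewrite mderivM scalerDr scalerAl scalerAr.
Qed.

Lemma dirderC a x : dirder a x%:MP = 0.
Proof. by apply: big1 => k _; rewrite mderivC scaler0. Qed.

Lemma dirder_linf a u : dirder a (linf u) = ((u *m a) 0 0)%:MP.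
Proof.
rewrite /dirder /linf !mxE rmorph_sum; apply: eq_bigr => k _.
rewrite (raddf_sum (mderiv k)) (bigD1 k) //= big1 => [|l lk]; last first.
  by rewrite mderivZ mderivX mnm1E (negPf lk) scale0r scaler0.
have kk : (U_(k) - U_(k))%MM = 0%MM :> 'X_{1..4}.
  by apply/mnmP => i; rewrite mnmBE mnm0E subnn.
rewrite addr0 mderivZ mderivX mnm1E eqxx kk mpolyX0 scale1r scalerA.
by rewrite -mul_mpolyC mulr1 mulrC.
Qed.

Lemma polarD v w a b c : polar (v + w) a b c = polar v a b c + polar w a b c.
Proof. by rewrite /polar !dirderD mcoeffD. Qed.

Lemma polarZ x w a b c : polar (x *: w) a b c = x * polar w a b c.
Proof. by rewrite /polar !dirderZ mcoeffZ. Qed.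

(** By the product rule each of the three derivatives falls on a different factor, in six possible
    ways. *)
Lemma polar_linf3 (u1 u2 u3 : 'rV[R[i]]_4) a b c :
  let e u x := (u *m x) 0 0 in
  polar (linf u1 * linf u2 * linf u3) a b c =
    e u1 a * e u2 b * e u3 c + e u1 a * e u2 c * e u3 b
    + e u1 b * e u2 a * e u3 c + e u1 b * e u2 c * e u3 a
    + e u1 c * e u2 a * e u3 b + e u1 c * e u2 b * e u3 a.
Proof.
move=> e.
have d1 x u : dirder x (linf u) = (e u x)%:MP by exact: dirder_linf.
have dC x y (p : {mpoly R[i][4]}) : dirder x (y%:MP * p) = y%:MP * dirder x p.
  by rewrite dirderM dirderC mul0r add0r.
have d2 x u (v : 'rV_4) :
    dirder x (linf u * linf v) = (e u x)%:MP * linf v + (e v x)%:MP * linf u.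
  by rewrite dirderM !d1 [linf u * _]mulrC.
have d3 x : dirder x (linf u1 * linf u2 * linf u3) =
    (e u1 x)%:MP * (linf u2 * linf u3) + (e u2 x)%:MP * (linf u1 * linf u3)
    + (e u3 x)%:MP * (linf u1 * linf u2).
  by rewrite dirderM d2 d1; ring.
rewrite /polar d3 !(dirderD, dC, d2, d1).
rewrite -!(mpolyCM, mpolyCD) mcoeffC eqxx mulr1 {d1 dC d2}.
move: (e u1 a) (e u1 b) (e u1 c) (e u2 a) (e u2 b) (e u2 c) (e u3 a) (e u3 b) (e u3 c).
by move=> *; ring.
Qed.

(** The constant term of a third partial derivative is an integer multiple of a single coefficient
    of degree 3. *)
Lemma form_fun_polar a b c : form_fun 1 (fun w => polar w a b c).
Proof.
rewrite /polar /dirder.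
suff h : forall i j k, form_fun 1 (fun w => (w^`M(i)^`M(j)^`M(k))@_0).
  have : form_fun 1 (fun w => \sum_k c k 0 * (\sum_j b j 0 * (\sum_i a i 0 *
          (w^`M(i)^`M(j)^`M(k))@_0))).
    by do 3 (apply: form_fun_sum => ?; apply: form_funZ).
  move=> [F hF eF]; exists F => // w; rewrite -eF raddf_sum; apply: eq_bigr => k _.
  rewrite /= mcoeffZ (raddf_sum (mderiv k)) raddf_sum; congr (_ * _); apply: eq_bigr => j _.
  rewrite /= mderivZ mcoeffZ (raddf_sum (mderiv j)) (raddf_sum (mderiv k)) raddf_sum;
    congr (_ * _); apply: eq_bigr => i _.
  by rewrite /= !mderivZ mcoeffZ.
move=> i j k.
have [F hF eF] : form_fun 1 (fun w : {mpoly R[i][4]} => w@_(0 + U_(k) + U_(j) + U_(i))).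
  by apply: form_fun_coef; rewrite !mdegD !mdeg1 mdeg0.
(* These are the exponents brought down by the derivatives along [i] and [j]; the one along [k]
   gives the third factor. *)
set n := ((0 + U_(k) + U_(j))%MM i).+1; set m := ((0 + U_(k))%MM j).+1.
exists ((n * m * ((0%MM : 'X_{1..4}) k).+1)%:R *: F).
  exact: dhomogZ.
by move=> w; rewrite mevalZ -eF !mcoeff_deriv mulr_natl !mulrnA.
Qed.

End Polar.

(** * Linear substitutions *)

Section Substitution.
Variable R : realType.
Implicit Types (v w : {mpoly R[i][4]}) (g h : 'M[R[i]]_4).

Lemma linear_substD g v w : linear_subst g (v + w) = linear_subst g v + linear_subst g w.
Proof. exact: rmorphD. Qed.

Lemma linear_subst_sum g (I : Type) (r : seq I) (F : I -> {mpoly R[i][4]}) :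
  linear_subst g (\sum_(i <- r) F i) = \sum_(i <- r) linear_subst g (F i).
Proof. by rewrite /linear_subst raddf_sum. Qed.

Lemma linear_substM g v w : linear_subst g (v * w) = linear_subst g v * linear_subst g w.
Proof. exact: rmorphM. Qed.

Lemma linear_substZ g (x : R[i]) w : linear_subst g (x *: w) = x *: linear_subst g w.
Proof. exact: comp_mpolyZ. Qed.

Lemma linear_substX g i : linear_subst g 'X_i = linf (row i g).
Proof.
rewrite /linear_subst comp_mpolyXU -tnth_nth tnth_mktuple.
by apply: eq_bigr => j _; rewrite mxE.
Qed.

Lemma linear_subst1 v : linear_subst 1%:M v = v.
Proof.
rewrite /linear_subst; set t := [tuple _ | i < 4].
have -> : t = [tuple 'X_i | i < 4]; last exact: comp_mpoly_id.
apply: eq_mktuple => i.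
rewrite (bigD1 i) //= mxE eqxx scale1r big1 ?addr0 // => j ji.
by rewrite mxE eq_sym (negPf ji) scale0r.
Qed.

Lemma linear_subst_linf g u : linear_subst g (linf u) = linf (u *m g).
Proof.
rewrite /linf linear_subst_sum.
transitivity (\sum_k \sum_j (u 0 k * g k j) *: ('X_j : {mpoly R[i][4]})).
  apply: eq_bigr => k _; rewrite linear_substZ linear_substX scaler_sumr.
  by apply: eq_bigr => j _; rewrite mxE scalerA.
rewrite exchange_big; apply: eq_bigr => j _.
by rewrite mxE scaler_suml.
Qed.

Lemma linear_subst_monomial g (m : 'X_{1..4}) :
  linear_subst g 'X_[m] = \prod_i linf (row i g) ^+ m i.
Proof.
rewrite /linear_subst comp_mpolyX; apply: eq_bigr => i _.
rewrite tnth_mktuple; congr (_ ^+ _).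
by apply: eq_bigr => j _; rewrite mxE.
Qed.

(** Substitution is a right action. By linearity a monomial suffices; it becomes a product of linear
    forms given by rows of [g], and [h] multiplies these rows on the right. *)
Lemma linear_subst_comp g h v :
  linear_subst h (linear_subst g v) = linear_subst (g *m h) v.
Proof.
rewrite [v]mpolyE (linear_subst_sum g (msupp v)) (linear_subst_sum h (msupp v)).
rewrite (linear_subst_sum _ (msupp v)); apply: eq_bigr => m _.
rewrite !linear_substZ !linear_subst_monomial /linear_subst rmorph_prod.
congr (_ *: _); apply: eq_bigr => i _.
by rewrite rmorphXn /= -/(linear_subst h _) linear_subst_linf row_mul.
Qed.

Lemma dhomog_linear_subst d g v : v \is d.-homog -> linear_subst g v \is d.-homog.
Proof.
move=> /dhomogP hv; rewrite /linear_subst comp_mpolyE big_seq.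
set t := [tuple _ | _ < 4].
have ht i : tnth t i \is 1.-homog.
  rewrite tnth_mktuple; apply: rpred_sum => j _.
  by rewrite dhomogZ // dhomogX; apply/eqP/mdeg1.
apply: rpred_sum => m mv; rewrite dhomogZ //.
have <- : mdeg m = d by exact: hv.
rewrite mdegE; elim: (index_enum _) => [|i r IH]; first by rewrite !big_nil dhomog1.
rewrite !big_cons; apply: dhomogM IH; rewrite -[X in X.-homog]mul1n.
exact: dhomogMn.
Qed.

Lemma is_cubic_orbit v w : is_cubic v -> pgl_orbit v w -> is_cubic w.
Proof.
move=> [v0 hv] [g [c [gu c0 ->]]]; split; last by rewrite dhomogZ // dhomog_linear_subst.
rewrite scaler_eq0 negb_or c0; apply: contra v0 => /eqP e.
(* Substituting the inverse of [g] recovers [v], so [v] would be 0 if its transform were. *)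
by rewrite -[v]linear_subst1 -(mulmxV gu) -linear_subst_comp e /linear_subst comp_mpoly0.
Qed.

Lemma pgl_orbit_refl v : pgl_orbit v v.
Proof.
by exists 1%:M, 1; rewrite unitmx1 oner_neq0 linear_subst1 scale1r.
Qed.

End Substitution.

(** * Orbit closures and limits along polynomial curves *)

Lemma poly_infinite_roots (K : numFieldType) (p : {poly K}) :
  (forall s, s != 0 -> p.[s] = 0) -> p = 0.
Proof.
move=> h; apply/eqP/negPn/negP => p0.
(* The numbers 1, ..., [size p] are nonzero and distinct in characteristic 0, which is one root too
   many. *)
pose rs := [seq n.+1%:R : K | n <- iota 0 (size p)].
suff : (size rs < size p)%N by rewrite size_map size_iota ltnn.
apply: max_poly_roots p0 _ _.
  by apply/allP => x /mapP[n _ ->]; apply/rootP/h; rewrite pnatr_eq0.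
rewrite map_inj_uniq ?iota_uniq // => m n /eqP.
by rewrite eqr_nat => /eqP[].
Qed.

(** [mmap polyC q F] is the restriction of [F] to the polynomial curve [q]. *)
Lemma horner_mmap (K : comNzRingType) (n : nat) (F : {mpoly K[n]}) (q : 'I_n -> {poly K}) s :
  (mmap polyC q F).[s] = F.@[fun k => (q k).[s]].
Proof.
rewrite /meval /mmap horner_sum; apply: eq_bigr => m _.
rewrite hornerM hornerC horner_prod; congr (_ * _).
by apply: eq_bigr => i _; rewrite horner_exp.
Qed.

Section Closure.
Variable R : realType.

Lemma cubic_coordD (v w : {mpoly R[i][4]}) k :
  cubic_coord (v + w) k = cubic_coord v k + cubic_coord w k.
Proof. exact: mcoeffD. Qed.

Lemma cubic_coordZ x (w : {mpoly R[i][4]}) k :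
  cubic_coord (x *: w) k = x * cubic_coord w k.
Proof. exact: mcoeffZ. Qed.

Lemma cubic_coord_sum (I : Type) (r : seq I) (F : I -> {mpoly R[i][4]}) k :
  cubic_coord (\sum_(i <- r) F i) k = \sum_(i <- r) cubic_coord (F i) k.
Proof. exact: (raddf_sum (mcoeff _)). Qed.

Implicit Types (l r c : label) (P : {mpoly R[i][4]} -> R[i]).

Lemma degen_trans r l c : degen R r l -> degen R l c -> degen R r c.
Proof. by move=> rl lc w /rl /lc. Qed.

(** The zero locus of [P] among cubic forms is closed and contains the orbit of [c], hence its
    closure; but [r] lies in its own orbit closure and outside this locus. *)
Lemma not_degen d r c P :
    is_cubic (cubic R c) -> form_fun d P ->
    (forall u, pgl_orbit (cubic R c) u -> P u = 0) -> P (cubic R r) != 0 ->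
  ~ degen R r c.
Proof.
move=> cc [F hF eF] Pc Pr rc.
have cl : orbit_closure (cubic R r) (cubic R r) by move=> Z _; apply; apply: pgl_orbit_refl.
have [|u uc|_ e] := rc _ cl (fun w => is_cubic w /\ P w = 0).
- exists (fun G => G = F); split=> [G ->|w]; first by exists d.
  split=> [[cw Pw]|[cw h]]; split=> //; first by move=> G ->; rewrite -eF.
  by rewrite eF; apply: h.
- by split; [apply: is_cubic_orbit uc | apply: Pc].
- by rewrite e eqxx in Pr.
Qed.

(** [Ws] lists the coefficients of s, s^2, ... in the rescaled curve, so that its value at s = 0 is
    the cubic [r]. *)
Lemma degen_curve r c (g : R[i] -> 'M_4) (k : R[i] -> R[i]) (Ws : seq {mpoly R[i][4]}) :
    is_cubic (cubic R r) ->
    (forall s, s != 0 -> [/\ g s \in unitmx, k s != 0 &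
      linear_subst (g s) (cubic R c) =
        k s *: (cubic R r + \sum_(j < size Ws) s ^+ j.+1 *: Ws`_j)]) ->
  degen R r c.
Proof.
move=> cr hg w clw Z cZ cs; apply: clw (cZ) _ => u ru.
have cu := is_cubic_orbit cr ru; case: cZ => E [hE ZE]; apply/ZE; split=> // F EF.
case: ru => h [x [hu x0 ->]].
(* The curve is moved by [h] and [x], so that it ends at the chosen point [u] of the orbit of
   [r]. *)
pose V s := x *: linear_subst h (cubic R r + \sum_(j < size Ws) s ^+ j.+1 *: Ws`_j).
have ZV s : s != 0 -> F.@[cubic_coord (V s)] = 0.
  move=> s0; have [gu k0 e] := hg s s0.
  suff : Z (V s) by move=> /ZE[_]; apply.
  apply: cs; exists (g s *m h), (x / k s).
  split; [by rewrite unitmx_mul gu | by rewrite mulf_neq0 ?invr_eq0 |].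
  by rewrite -linear_subst_comp e linear_substZ scalerA divfK.
(* The coordinates of [V s] as polynomials in s; unlike the orbit condition, they make sense at s =
   0. *)
pose q i := (x * cubic_coord (linear_subst h (cubic R r)) i)%:P +
  \sum_(j < size Ws) (x * cubic_coord (linear_subst h Ws`_j) i) *: 'X^(j.+1).
have qE s i : (q i).[s] = cubic_coord (V s) i.
  rewrite [LHS]hornerD hornerC horner_sum cubic_coordZ linear_substD cubic_coordD mulrDr.
  congr (_ + _); rewrite linear_subst_sum cubic_coord_sum mulr_sumr.
  apply: eq_bigr => j _; rewrite linear_substZ cubic_coordZ hornerZ hornerXn.
  by rewrite mulrAC -mulrA.
have q0 : mmap polyC q F = 0.
  apply: poly_infinite_roots => s s0; rewrite horner_mmap -(ZV s s0).
  exact: meval_eq.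
have := horner_mmap F q 0; rewrite q0 horner0 => /esym; rewrite (meval_eq _ (qE 0)).
rewrite /V big1 ?addr0 // => j _.
by rewrite expr0n scale0r.
Qed.

End Closure.

(** * Explicit determinants, and the thirteen cubics with their polars *)

Local Notation o0 := (@Ordinal 4 0 isT).
Local Notation o1 := (@Ordinal 4 1 isT).
Local Notation o2 := (@Ordinal 4 2 isT).
Local Notation o3 := (@Ordinal 4 3 isT).

Lemma big_ord4 (V : nmodType) (F : 'I_4 -> V) :
  \sum_j F j = F o0 + F o1 + F o2 + F o3.
Proof.
rewrite !big_ord_recl big_ord0 addr0 !addrA.
by congr (_ + _ + _ + _); congr (F _); apply: val_inj.
Qed.

Lemma det_mx33 (K : comNzRingType) (M : 'M[K]_3) :
  let m i j := M (inord i) (inord j) in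
  \det M = m 0%N 0%N * (m 1%N 1%N * m 2%N 2%N - m 1%N 2%N * m 2%N 1%N)
    - m 0%N 1%N * (m 1%N 0%N * m 2%N 2%N - m 1%N 2%N * m 2%N 0%N)
    + m 0%N 2%N * (m 1%N 0%N * m 2%N 1%N - m 1%N 1%N * m 2%N 0%N).
Proof.
move=> m; have mE (i j : 'I_3) : M i j = m i j by rewrite /m !inord_val.
rewrite (expand_det_row _ ord0) !big_ord_recl big_ord0 /cofactor.
rewrite !(expand_det_row _ ord0) !big_ord_recl !big_ord0 /cofactor !det_mx11 !mxE !mE /=.
by rewrite /bump /=; ring.
Qed.

Definition mx4 (K : nmodType) (s : seq (seq K)) : 'M[K]_4 :=
  \matrix_(i, j) nth 0 (nth [::] s i) j.

(** The right-hand side is the Laplace expansion along the first two rows. *)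
Lemma det_mx4E (K : comNzRingType) (a0 a1 a2 a3 b0 b1 b2 b3 c0 c1 c2 c3 d0 d1 d2 d3 : K) :
  \det (mx4 [:: [:: a0; a1; a2; a3]; [:: b0; b1; b2; b3];
                [:: c0; c1; c2; c3]; [:: d0; d1; d2; d3]]) =
  (a0 * b1 - a1 * b0) * (c2 * d3 - c3 * d2) - (a0 * b2 - a2 * b0) * (c1 * d3 - c3 * d1)
  + (a0 * b3 - a3 * b0) * (c1 * d2 - c2 * d1) + (a1 * b2 - a2 * b1) * (c0 * d3 - c3 * d0)
  - (a1 * b3 - a3 * b1) * (c0 * d2 - c2 * d0) + (a2 * b3 - a3 * b2) * (c0 * d1 - c1 * d0).
Proof.
rewrite (expand_det_row _ ord0) !big_ord_recl big_ord0 /cofactor !det_mx33 !mxE /=.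
by rewrite /bump /= !inordK //=; ring.
Qed.

Definition triple : Type := 'I_4 * 'I_4 * 'I_4.

Definition monomial3 (R : realType) (t : triple) : {mpoly R[i][4]} :=
  'X_t.1.1 * 'X_t.1.2 * 'X_t.2.

(** The polar of the monomial x_i x_j x_k: a permanent in the coordinates of [a], [b], [c]. *)
Definition perm3 (K : comNzRingType) (a b c : 'cV[K]_4) (t : triple) : K :=
  let: (i, j, k) := t in
  a i 0 * b j 0 * c k 0 + a i 0 * c j 0 * b k 0 + b i 0 * a j 0 * c k 0
  + b i 0 * c j 0 * a k 0 + c i 0 * a j 0 * b k 0 + c i 0 * b j 0 * a k 0.

Definition cubic_terms (R : realType) (l : label) : seq (R[i] * triple) :=
  match l with
  | L1A => [:: (1, (o0, o0, o0))]
  | L2A => [:: (1, (o0, o0, o0)); (1, (o1, o1, o1))]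
  | L3A => [:: (1, (o0, o0, o1))]
  | L4A => [:: (1, (o1, o1, o2)); (-1, (o0, o0, o0)); (-1, (o0, o0, o2))]
  | L4B => [:: (1, (o1, o1, o2)); (-1, (o0, o0, o0))]
  | L4C => [:: (1, (o0, o0, o0)); (1, (o0, o1, o2))]
  | L4D => [:: (1, (o0, o1, o2))]
  | L5A => [:: (1, (o0, o0, o1)); (1, (o1, o1, o2))]
  | L6A => [:: (1, (o0, o0, o0)); (1, (o0, o1, o1)); (1, (o0, o2, o2)); (1, (o0, o3, o3))]
  | L6B => [:: (1, (o0, o1, o1)); (1, (o0, o2, o2)); (1, (o0, o3, o3))]
  | L6C => [:: (1, (o0, o1, o1)); (1, (o2, o3, o3))]
  | L7A => [:: (1, (o0, o0, o1)); (1, (o0, o2, o2)); (1, (o0, o3, o3))]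
  | L7B => [:: (1, (o0, o0, o1)); (1, (o0, o2, o3)); (1, (o2, o2, o2))]
  end.

Definition cubic_polar (R : realType) (l : label) (a b c : 'cV[R[i]]_4) : R[i] :=
  let s i j k := perm3 a b c (i, j, k) in
  match l with
  | L1A => s o0 o0 o0
  | L2A => s o0 o0 o0 + s o1 o1 o1
  | L3A => s o0 o0 o1
  | L4A => s o1 o1 o2 - s o0 o0 o0 - s o0 o0 o2
  | L4B => s o1 o1 o2 - s o0 o0 o0
  | L4C => s o0 o0 o0 + s o0 o1 o2
  | L4D => s o0 o1 o2
  | L5A => s o0 o0 o1 + s o1 o1 o2
  | L6A => s o0 o0 o0 + s o0 o1 o1 + s o0 o2 o2 + s o0 o3 o3
  | L6B => s o0 o1 o1 + s o0 o2 o2 + s o0 o3 o3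
  | L6C => s o0 o1 o1 + s o2 o3 o3
  | L7A => s o0 o0 o1 + s o0 o2 o2 + s o0 o3 o3
  | L7B => s o0 o0 o1 + s o0 o2 o3 + s o2 o2 o2
  end.

Definition vec4 (K : nmodType) (s : seq K) : 'cV[K]_4 := \col_i nth 0 s i.

Section CubicPolar.
Variable R : realType.
Implicit Types (g h : 'M[R[i]]_4) (a b c : 'cV[R[i]]_4).

Lemma cubicE l : cubic R l = \sum_(t <- cubic_terms R l) t.1 *: monomial3 R t.2.
Proof.
by case: l; rewrite /cubic /= ?big_cons big_nil /monomial3 /= ?scale1r ?scaleN1r; ring.
Qed.

Lemma cubic_polarE l a b c :
  cubic_polar l a b c = \sum_(t <- cubic_terms R l) t.1 * perm3 a b c t.2.
Proof.
rewrite /cubic_polar; move: (perm3 a b c) => s.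
by case: l; rewrite unlock /= ?mul1r ?mulN1r addr0 ?addrA.
Qed.

Lemma polar_linear_subst_cubic l g a b c :
  polar (linear_subst g (cubic R l)) a b c = cubic_polar l (g *m a) (g *m b) (g *m c).
Proof.
rewrite cubicE linear_subst_sum cubic_polarE.
have p0 : polar (0 : {mpoly R[i][4]}) a b c = 0.
  by rewrite -(scale0r 0) polarZ mul0r.
elim: (cubic_terms R l) => [|[x [[i j] k]] s IH]; first by rewrite !big_nil.
rewrite !big_cons polarD IH linear_substZ polarZ /= !linear_substM !linear_substX.
rewrite polar_linf3 -!row_mul; congr (_ * _ + _).
by rewrite /perm3 ![row _ _ 0 0]mxE.
Qed.

Lemma polar_orbit l u : pgl_orbit (cubic R l) u ->
  exists g x, forall a b c, polar u a b c = x * cubic_polar l (g *m a) (g *m b) (g *m c).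
Proof.
move=> [g [x [_ _ ->]]]; exists g, x => a b c.
by rewrite polarZ polar_linear_subst_cubic.
Qed.

Lemma polar_cubic l a b c : polar (cubic R l) a b c = cubic_polar l a b c.
Proof. by rewrite -[cubic R l]linear_subst1 polar_linear_subst_cubic !mul1mx. Qed.

Lemma is_cubic_cubic l : is_cubic (cubic R l).
Proof.
split; last first.
  rewrite cubicE; apply: rpred_sum => t _; rewrite dhomogZ //.
  have h i : ('X_i : {mpoly R[i][4]}) \is 1.-homog by rewrite dhomogX; apply/eqP/mdeg1.
  exact: dhomogM (dhomogM (h _) (h _)) (h _).
(* A nonzero value of the polar shows that the cubic is nonzero; an integer value stays nonzero in
   characteristic 0. *)
suff [a [b [c [n nz e]]]] :
    exists a b c, exists2 n : int, n != 0 & polar (cubic R l) a b c = n%:~R.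
  have : polar (cubic R l) a b c != 0 by rewrite e intr_eq0.
  by apply: contraNneq => ->; rewrite -(scale0r 0) polarZ mul0r.
pose x : 'cV[R[i]]_4 := vec4 [:: 1; 0; 0; 0]; pose y : 'cV[R[i]]_4 := vec4 [:: 0; 1; 0; 0].
pose z : 'cV[R[i]]_4 := vec4 [:: 0; 0; 1; 0].
have E a b c n : n != 0 -> cubic_polar l a b c = n%:~R ->
    exists a b c, exists2 n : int, n != 0 & polar (cubic R l) a b c = n%:~R.
  by move=> n0 e; exists a, b, c, n; rewrite ?polar_cubic.
case: l E => E; [apply: (E x x x 6) | apply: (E x x x 6) | apply: (E x x y 2)
  | apply: (E x x x (- 6)) | apply: (E x x x (- 6)) | apply: (E x x x 6) | apply: (E x y z 1)
  | apply: (E x x y 2) | apply: (E x x x 6) | apply: (E x y y 2) | apply: (E x y y 2)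
  | apply: (E x x y 2) | apply: (E x x y 2)] => //;
by rewrite /cubic_polar /perm3 !mxE /=; ring.
Qed.

End CubicPolar.

Lemma linear_subst_cubic (R : realType) (g : 'M[R[i]]_4) l :
  linear_subst g (cubic R l) =
  \sum_(t <- cubic_terms R l) t.1%:MP *
    (linf (row t.2.1.1 g) * linf (row t.2.1.2 g) * linf (row t.2.2 g)).
Proof.
rewrite cubicE linear_subst_sum; apply: eq_bigr => t _.
by rewrite linear_substZ /monomial3 !linear_substM !linear_substX mul_mpolyC.
Qed.

Lemma linf_row4 (R : realType) (i : 'I_4) (s : seq (seq R[i])) :
  let r := nth [::] s i in
  linf (row i (mx4 s)) = r`_0 *: 'X_o0 + r`_1 *: 'X_o1 + r`_2 *: 'X_o2 + r`_3 *: 'X_o3.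
Proof. by rewrite /linf big_ord4 !mxE. Qed.

Ltac expand_family :=
  rewrite linear_subst_cubic cubicE /= ?big_cons !big_nil /monomial3 /=
    ?big_ord_recl big_ord0 /= /bump /= !linf_row4 /= -!mul_mpolyC.

Ltac nonzero_numeral := by rewrite ?oppr_eq0 ?pnatr_eq0 ?oner_eq0.

(** * Degenerations *)

Section Families.
Variable R : realType.

(** A determinant and a leading factor that are monomials in s cannot vanish for s != 0, so two
    polynomial identities suffice. *)
Lemma degen_rows (rows : R[i] -> seq (seq R[i])) (x y : R[i]) (p m : nat)
    (Ws : seq {mpoly R[i][4]}) r c :
    x != 0 -> y != 0 -> (forall s, \det (mx4 (rows s)) = x * s ^+ p) ->
    (forall s, linear_subst (mx4 (rows s)) (cubic R c) =
      (y * s ^+ m) *: (cubic R r + \sum_(j < size Ws) s ^+ j.+1 *: Ws`_j)) ->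
  degen R r c.
Proof.
move=> x0 y0 hdet hsub; apply: degen_curve (is_cubic_cubic R r) _ => s s0.
split; last exact: hsub; last by rewrite mulf_neq0 ?expf_neq0.
by rewrite unitmxE hdet unitfE mulf_neq0 ?expf_neq0.
Qed.

(** The plane x2 turns into the double plane x1. *)
Lemma degen_1A_3A : degen R L1A L3A.
Proof.
apply: (@degen_rows (fun s => [:: [:: 1; 0; 0; 0]; [:: 1; s; 0; 0]; [:: 0; 0; 1; 0];
  [:: 0; 0; 0; 1]])
  1 1 1 0 [:: 'X_o0 ^+ 2 * 'X_o1]) => [||s|s]; try nonzero_numeral.
  by rewrite det_mx4E; ring.
by expand_family; ring.
Qed.

(** A difference quotient of the cube: ((x1 + 3 s x2)^3 - x1^3) / (9 s) tends to x1^2 x2. *)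
Lemma degen_3A_2A : degen R L3A L2A.
Proof.
apply: (@degen_rows (fun s => [:: [:: 1; 3 * s; 0; 0]; [:: -1; 0; 0; 0]; [:: 0; 0; 1; 0];
  [:: 0; 0; 0; 1]])
  3 9 1 1 [:: 3 * ('X_o0 * 'X_o1 ^+ 2); 3 * 'X_o1 ^+ 3]) => [||s|s]; try nonzero_numeral.
  by rewrite det_mx4E; ring.
by expand_family; ring.
Qed.

(** At s = 0 the quadric becomes 9 (x1 - x2)^2 + 3 (x1 + x2)^2 = 12 (x1^2 - x1 x2 + x2^2), the
    cofactor of x1 + x2 in 12 (x1^3 + x2^3). *)
Lemma degen_2A_5A : degen R L2A L5A.
Proof.
apply: (@degen_rows (fun s => [:: [:: 3; -3; 0; 0]; [:: 1; 1; 0; 0]; [:: 3; 3; 12 * s; 0];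
  [:: 0; 0; 0; 1]])
  72 12 1 0 [:: ('X_o0 + 'X_o1) ^+ 2 * 'X_o2]) => [||s|s]; try nonzero_numeral.
  by rewrite det_mx4E; ring.
by expand_family; ring.
Qed.

(** With x1 scaled by s, the term x1^3 has order s^3 and x1 x2 x3 only order s; the leading 0 in the
    list is the absent relative order s. *)
Lemma degen_4D_4C : degen R L4D L4C.
Proof.
apply: (@degen_rows (fun s => [:: [:: s; 0; 0; 0]; [:: 0; 1; 0; 0]; [:: 0; 0; 1; 0];
  [:: 0; 0; 0; 1]])
  1 1 1 1 [:: 0; 'X_o0 ^+ 3]) => [||s|s]; try nonzero_numeral.
  by rewrite det_mx4E; ring.
by expand_family; ring.
Qed.

(* The secant x2 + s^2 x3 of the conic x1^2 + x2 x3 becomes tangent as s -> 0. *)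
Lemma degen_5A_4C : degen R L5A L4C.
Proof.
apply: (@degen_rows (fun s => [:: [:: 0; 1; s ^+ 2; 0]; [:: 2 * s; 1; - s ^+ 2; 0];
  [:: 2 * s; -1; s ^+ 2; 0]; [:: 0; 0; 0; 1]])
  (-8) 4 3 2 [:: 0; 'X_o2 * ('X_o0 ^+ 2 + 'X_o1 * 'X_o2)]) => [||s|s]; try nonzero_numeral.
  by rewrite det_mx4E; ring.
by expand_family; ring.
Qed.

(** The image of x3 is chosen to cancel the terms x2^3 and x1 x2^2 of (3 s x1 - x2)^3; what survives
    at order s^2 is 5A. *)
Lemma degen_5A_4B : degen R L5A L4B.
Proof.
apply: (@degen_rows (fun s => [:: [:: 3 * s; -1; 0; 0]; [:: 0; 1; 0; 0];
  [:: 9 * s; -1; 27 * s ^+ 2; 0]; [:: 0; 0; 0; 1]])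
  81 27 3 2 [:: - 'X_o0 ^+ 3]) => [||s|s]; try nonzero_numeral.
  by rewrite det_mx4E; ring.
by expand_family; ring.
Qed.

(** With weights 1, 0, 3 for x1, x2, x3 the cuspidal terms have weight 3 and x1^2 x3 has weight
    5. *)
Lemma degen_4B_4A : degen R L4B L4A.
Proof.
apply: (@degen_rows (fun s => [:: [:: s; 0; 0; 0]; [:: 0; 1; 0; 0]; [:: 0; 0; s ^+ 3; 0];
  [:: 0; 0; 0; 1]])
  1 1 4 3 [:: 0; - ('X_o0 ^+ 2 * 'X_o2)]) => [||s|s]; try nonzero_numeral.
  by rewrite det_mx4E; ring.
by expand_family; ring.
Qed.

Lemma degen_4B_7B : degen R L4B L7B.
Proof.
apply: (@degen_rows (fun s => [:: [:: 0; 1; 0; 0]; [:: 0; 0; 1; 0]; [:: -1; 0; 0; 0];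
  [:: 0; 0; 0; s]])
  (-1) 1 1 0 [:: - ('X_o0 * 'X_o1 * 'X_o3)]) => [||s|s]; try nonzero_numeral.
  by rewrite det_mx4E; ring.
by expand_family; ring.
Qed.

(* u = x2 - x1 and w = x2 + x1 are the tangents at the node; u, w, x3 get weights 1, 2, 0. *)
Lemma degen_4C_4A : degen R L4C L4A.
Proof.
apply: (@degen_rows (fun s => [:: [:: -4 * s; 4 * s ^+ 2; 0; 0];
  [:: 4 * s; 4 * s ^+ 2; 0; 0]; [:: 3 * s; -3 * s ^+ 2; 1; 0]; [:: 0; 0; 0; 1]])
  (-32) 64 3 3 [:: 0; 0; - 'X_o1 ^+ 3]) => [||s|s]; try nonzero_numeral.
  by rewrite det_mx4E; ring.
by expand_family; ring.
Qed.

(** To first order x2 is sent to s x1, which turns x1^2 x2 into x1^3; the part s^2 x4 keeps the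
    matrix invertible. *)
Lemma degen_4C_7B : degen R L4C L7B.
Proof.
apply: (@degen_rows (fun s => [:: [:: 1; 0; 0; 0]; [:: s; 0; 0; s ^+ 2]; [:: 0; 0; s; 0];
  [:: 0; 1; 0; 0]])
  (-1) 1 3 1 [:: 'X_o0 ^+ 2 * 'X_o3; 'X_o2 ^+ 3]) => [||s|s]; try nonzero_numeral.
  by rewrite det_mx4E; ring.
by expand_family; ring.
Qed.

(** At s = 0 this is a hyperplane section of 6C; the term s x4 makes the substitution invertible. *)
Lemma degen_4A_6C : degen R L4A L6C.
Proof.
apply: (@degen_rows (fun s => [:: [:: 0; 0; 1; 0]; [:: 0; 1; 0; 0]; [:: -1; 0; -1; s];
  [:: 1; 0; 0; 0]])
  1 1 1 0 [:: 'X_o0 ^+ 2 * 'X_o3]) => [||s|s]; try nonzero_numeral.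
  by rewrite det_mx4E; ring.
by expand_family; ring.
Qed.

Lemma degen_6B_6A : degen R L6B L6A.
Proof.
apply: (@degen_rows (fun s => [:: [:: s; 0; 0; 0]; [:: 0; 1; 0; 0]; [:: 0; 0; 1; 0];
  [:: 0; 0; 0; 1]])
  1 1 1 1 [:: 0; 'X_o0 ^+ 3]) => [||s|s]; try nonzero_numeral.
  by rewrite det_mx4E; ring.
by expand_family; ring.
Qed.

(* The planes x2 and x4 of 6C are sent to x1 - s x3 and x1 + s x3, which collide. *)
Lemma degen_7B_6C : degen R L7B L6C.
Proof.
apply: (@degen_rows (fun s => [:: [:: 1; 2 * s ^+ 3; 2 * s; - s ^+ 2]; [:: 1; 0; - s; 0];
  [:: -1; 2 * s ^+ 3; 2 * s; s ^+ 2]; [:: 1; 0; s; 0]])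
  8 4 6 3 [:: 0; 'X_o1 * 'X_o2 ^+ 2]) => [||s|s]; try nonzero_numeral.
  by rewrite det_mx4E; ring.
by expand_family; ring.
Qed.

Lemma exists_primitive_cube_root : exists2 w : R[i], w ^+ 2 = - w - 1 & w != 1.
Proof.
have two0 : 2 != 0 :> R[i] by nonzero_numeral.
have [z hz] : exists z : R[i], z ^+ 2 = - 3 by exists (sqrtC (- 3)); rewrite sqrtCK.
exists ((z - 1) / 2).
  by rewrite expr_div_n sqrrB hz; field.
apply/eqP => e; have : z = 3 by rewrite -[z](subrK 1) -[z - 1](divfK two0) e; ring.
move=> ez; move: hz; rewrite ez => /eqP; rewrite -subr_eq0.
have -> : 3 ^+ 2 - - 3 = 12 :> R[i] by ring.
by rewrite pnatr_eq0.
Qed.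

Lemma degen_2A_4D : degen R L2A L4D.
Proof.
have [w ww w1] := exists_primitive_cube_root.
(* x1^3 + x2^3 splits into the factors x1 + w^i x2; adding s x3 to one of them makes the three
   independent. *)
apply: (@degen_rows (fun s => [:: [:: 1; 1; 0; 0]; [:: 1; w; 0; 0]; [:: 1; w ^+ 2; s; 0];
  [:: 0; 0; 0; 1]])
  (w - 1) 1 1 0 [:: ('X_o0 + 'X_o1) * ('X_o0 + w *: 'X_o1) * 'X_o2])
    => [||s|s]; try nonzero_numeral.
- by rewrite subr_eq0.
- by rewrite det_mx4E; ring.
have Cww : (w%:MP : {mpoly R[i][4]}) ^+ 2 = - w%:MP - 1.
  by rewrite -(rmorphXn (@mpolyC 4 R[i])) /= ww mpolyCD !mpolyCN.
by expand_family; ring: Cww.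
Qed.

Lemma sqr_imaginary : (('i : R[i])%:MP : {mpoly R[i][4]}) ^+ 2 = -1.
Proof. by rewrite -(rmorphXn (@mpolyC 4 R[i])) /= sqrCi mpolyCN. Qed.

Lemma degen_4C_6B : degen R L4C L6B.
Proof.
apply: (@degen_rows (fun s => [:: [:: 1; 0; 0; 0]; [:: 2; 0; 0; 2 * s]; [:: 0; 1; 1; 0];
  [:: 0; 'i; - 'i; 0]])
  (- (4 * 'i)) 4 1 0 [:: 2 * ('X_o0 ^+ 2 * 'X_o3); 'X_o0 * 'X_o3 ^+ 2])
    => [||s|s]; try nonzero_numeral.
- by rewrite ?oppr_eq0 mulf_neq0 ?neq0Ci; nonzero_numeral.
- by rewrite det_mx4E; ring.
by expand_family; ring: sqr_imaginary.
Qed.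

Lemma degen_4C_7A : degen R L4C L7A.
Proof.
apply: (@degen_rows (fun s => [:: [:: 1; 0; 0; 0]; [:: 4; 0; 0; 4 * s]; [:: 0; 1; 1; 0];
  [:: 0; 'i; - 'i; 0]])
  (- (8 * 'i)) 4 1 0 [:: 'X_o0 ^+ 2 * 'X_o3]) => [||s|s]; try nonzero_numeral.
- by rewrite ?oppr_eq0 mulf_neq0 ?neq0Ci; nonzero_numeral.
- by rewrite det_mx4E; ring.
by expand_family; ring: sqr_imaginary.
Qed.

(** The square of the image of x2 cancels x1^2, and in the limit the plane x1 is tangent to the
    quadric. *)
Lemma degen_7A_6A : degen R L7A L6A.
Proof.
apply: (@degen_rows (fun s => [:: [:: 1; 0; 0; 0]; [:: 'i; - 2 * 'i * s ^+ 2; 0; 0];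
    [:: 0; 0; 2 * s; 0]; [:: 0; 0; 0; 2 * s]])
  (- 8 * 'i) 4 4 2 [:: 0; - ('X_o0 * 'X_o1 ^+ 2)]) => [||s|s]; try nonzero_numeral.
- by rewrite ?oppr_eq0 mulf_neq0 ?neq0Ci; nonzero_numeral.
- by rewrite det_mx4E; ring.
by expand_family; ring: sqr_imaginary.
Qed.

End Families.

(** * Hessian determinants *)

Definition det3 (K : comNzRingType) (a b c d e f g h i : K) : K :=
  a * (e * i - f * h) - b * (d * i - f * g) + c * (d * h - e * g).

(* If [T] is the polar of a cubic form, then [T x b b'] is its second derivative at [x] in
   the directions [b] and [b']. *)
Definition hess3 (K : comNzRingType) (T : 'cV[K]_4 -> 'cV[K]_4 -> 'cV[K]_4 -> K)
    (b0 b1 b2 x : 'cV[K]_4) : K :=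
  det3 (T x b0 b0) (T x b0 b1) (T x b0 b2) (T x b1 b0) (T x b1 b1) (T x b1 b2)
       (T x b2 b0) (T x b2 b1) (T x b2 b2).

(** For a form in x1, x2, x3 alone, [hess3] depends on the basis of the hyperplane only through the
    square of this minor. *)
Definition minor3 (K : comNzRingType) (b0 b1 b2 : 'cV[K]_4) : K :=
  det3 (b0 o0 0) (b0 o1 0) (b0 o2 0) (b1 o0 0) (b1 o1 0) (b1 o2 0)
       (b2 o0 0) (b2 o1 0) (b2 o2 0).

Ltac expand_polar := rewrite /cubic_polar /perm3 /=.

(* Turning coordinates into variables keeps [ring] from comparing matrices. *)
Ltac coords_ring :=
  repeat match goal with
  | |- context [fun_of_matrix ?x ?i ?j] => generalize (fun_of_matrix x i j); intro
  end; ring.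

Definition hess4 (R : realType) (w : {mpoly R[i][4]}) (x : 'cV[R[i]]_4) : R[i] :=
  \det (\matrix_(i, j) polar w x (delta_mx i 0) (delta_mx j 0)).

Lemma form_fun_hess4 (R : realType) (x : 'cV[R[i]]_4) :
  form_fun 4 (fun w => hess4 w x).
Proof.
apply: form_fun_det => i j.
have [F hF eF] := form_fun_polar x (delta_mx i 0) (delta_mx j 0).
by exists F => // w; rewrite mxE.
Qed.

Lemma form_fun_hess3 (R : realType) (b0 b1 b2 x : 'cV[R[i]]_4) :
  form_fun (1 + (1 + 1)) (fun w => hess3 (polar w) b0 b1 b2 x).
Proof.
by rewrite /hess3 /det3; repeat first [exact: form_fun_polar | apply: form_funB
  | apply: form_funD | apply: form_funM].
Qed.

Ltac form_fun_tac :=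
  repeat first [exact: form_fun_polar | exact: form_fun_hess3 | exact: form_fun_hess4
    | apply: form_funB | apply: form_funD | apply: form_funZ | apply: form_funM].

Lemma ord4_cases (i : 'I_4) : [\/ i = o0, i = o1, i = o2 | i = o3].
Proof.
case: i => [[|[|[|[|//]]]] lt_i4]; [apply: Or41 | apply: Or42 | apply: Or43 | apply: Or44];
  exact: val_inj.
Qed.

(** * Non-degenerations *)

Section NonContainments.
Variable R : realType.
Local Notation K := R[i].
Local Notation vec := ('cV[R[i]]_4).
Implicit Types (a b c x y p q : vec).

Let e0 : vec := vec4 [:: 1; 0; 0; 0].
Let e1 : vec := vec4 [:: 0; 1; 0; 0].
Let e2 : vec := vec4 [:: 0; 0; 1; 0].
Let e3 : vec := vec4 [:: 0; 0; 0; 1].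

Lemma not_degen_3A_1A : ~ degen R L3A L1A.
Proof.
(* Up to sign, the Hessian determinant at [a] of the restriction to the span of [a] and [b]; it
   vanishes on cubes. *)
pose P (T : vec -> vec -> vec -> K) a b := T a a b * T a a b - T a a a * T a b b.
have P0 k a b : P (fun x y z => k * cubic_polar L1A x y z) a b = 0.
  by rewrite /P; expand_polar; coords_ring.
apply: (not_degen (P := fun w => P (polar w) e0 e1) (is_cubic_cubic _ _)).
- by rewrite /P; form_fun_tac.
- by move=> u /polar_orbit[g [k h]]; rewrite /P !h; apply: P0.
suff -> : P (polar (cubic R L3A)) e0 e1 = 4 by rewrite pnatr_eq0.
by rewrite /P !polar_cubic; expand_polar; rewrite !mxE /=; ring.
Qed.

Lemma not_degen_2A_3A : ~ degen R L2A L3A.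
Proof.
(* Up to a constant, the discriminant of the binary cubic with coefficients a, 3b, 3c, d; 3A
   restricts to one with a double root. *)
pose P (T : vec -> vec -> vec -> K) x y :=
  let a := T x x x in let b := T x x y in let c := T x y y in let d := T y y y in
  a * a * d * d - 6 * (a * b * c * d) + 4 * (a * c * c * c) + 4 * (b * b * b * d)
    - 3 * (b * b * c * c).
have P0 k x y : P (fun x y z => k * cubic_polar L3A x y z) x y = 0.
  by rewrite /P; expand_polar; coords_ring.
apply: (not_degen (P := fun w => P (polar w) e0 e1) (is_cubic_cubic _ _)).
- by rewrite /P; form_fun_tac.
- by move=> u /polar_orbit[g [k h]]; rewrite /P !h; apply: P0.
suff -> : P (polar (cubic R L2A)) e0 e1 = 1296%:R by rewrite pnatr_eq0.
by rewrite /P !polar_cubic; expand_polar; rewrite !mxE /=; ring.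
Qed.

(** The first derivatives of a form in two variables span at most a plane, so all 3 x 3 minors of
    their values at the pairs of vectors vanish. *)
Lemma not_degen_2A (p0 q0 p1 q1 p2 q2 : vec) r (n : nat) :
    (n != 0)%N ->
    (let T := @cubic_polar R r in
     det3 (T e0 p0 q0) (T e0 p1 q1) (T e0 p2 q2) (T e1 p0 q0) (T e1 p1 q1) (T e1 p2 q2)
       (T e2 p0 q0) (T e2 p1 q1) (T e2 p2 q2)) = n%:R ->
  ~ degen R r L2A.
Proof.
pose P T (b0 b1 b2 p0 q0 p1 q1 p2 q2 : vec) : K :=
  det3 (T b0 p0 q0) (T b0 p1 q1) (T b0 p2 q2) (T b1 p0 q0) (T b1 p1 q1) (T b1 p2 q2)
       (T b2 p0 q0) (T b2 p1 q1) (T b2 p2 q2).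
have P0 k b0 b1 b2 r0 s0 r1 s1 r2 s2 :
    P (fun x y z => k * cubic_polar L2A x y z) b0 b1 b2 r0 s0 r1 s1 r2 s2 = 0.
  by rewrite /P /det3; expand_polar; coords_ring.
move=> n0 /= e.
apply: (not_degen (P := fun w => P (polar w) e0 e1 e2 p0 q0 p1 q1 p2 q2) (is_cubic_cubic _ _)).
- by rewrite /P /det3; form_fun_tac.
- by move=> u /polar_orbit[g [k h]]; rewrite /P !h; apply: P0.
by rewrite /P !polar_cubic e pnatr_eq0.
Qed.

Lemma not_degen_4D_2A : ~ degen R L4D L2A.
Proof.
apply: (@not_degen_2A e1 e2 e0 e2 e0 e1 _ 1) => //.
by rewrite /det3; expand_polar; rewrite !mxE /=; ring.
Qed.

Lemma not_degen_5A_2A : ~ degen R L5A L2A.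
Proof.
apply: (@not_degen_2A e0 e1 e0 e0 e1 e1 _ 8) => //.
by rewrite /det3; expand_polar; rewrite !mxE /=; ring.
Qed.

Lemma not_degen_4A (p q : 'I_4 -> vec) r (n : nat) :
    (n != 0)%N ->
    \det (\matrix_(i, k) cubic_polar r (delta_mx i 0) (p k) (q k)) = n%:R :> R[i] ->
  ~ degen R r L4A.
Proof.
move=> n0 e.
(* The derivatives of 4A along the first three coordinates; the missing fourth entry reads as 0 and
   gives [G] below a zero row. *)
pose L (y z : vec) : seq K :=
  [:: - 6 * (y o0 0 * z o0 0) - 2 * (y o0 0 * z o2 0 + y o2 0 * z o0 0);
      2 * (y o1 0 * z o2 0 + y o2 0 * z o1 0); 2 * (y o1 0 * z o1 0) - 2 * (y o0 0 * z o0 0)].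
have L_polar b y z : cubic_polar L4A b y z = \sum_j b j 0 * (L y z)`_j.
  by rewrite big_ord4 /L; expand_polar; coords_ring.
apply: (not_degen
  (P := fun w => \det (\matrix_(i, k) polar w (delta_mx i 0) (p k) (q k)))
    (is_cubic_cubic _ _)).
- apply: form_fun_det => i k.
  by have [F hF eF] := form_fun_polar (delta_mx i 0) (p k) (q k); exists F => // w; rewrite mxE.
- move=> u /polar_orbit[g [x h]].
  pose G : 'M[K]_4 := \matrix_(j, k) (x * (L (g *m p k) (g *m q k))`_j).
  have -> : \matrix_(i, k) polar u (delta_mx i 0) (p k) (q k) = g^T *m G.
    apply/matrixP => i k; rewrite mxE h L_polar mulr_sumr [RHS]mxE.
    by apply: eq_bigr => j _; rewrite -colE !mxE mulrCA.
  rewrite det_mulmx (expand_det_row G o3) big1 ?mulr0 // => k _.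
  by rewrite mxE /= mulr0 mul0r.
suff -> : \det (\matrix_(i, k) polar (cubic R r) (delta_mx i 0) (p k) (q k)) = n%:R.
  by rewrite pnatr_eq0.
by rewrite -e; congr (\det _); apply/matrixP => i k; rewrite !mxE polar_cubic.
Qed.

Lemma not_degen_7A_4A : ~ degen R L7A L4A.
Proof.
apply: (@not_degen_4A (nth 0 [:: e0; e0; e0; e0]) (nth 0 [:: e1; e0; e2; e3]) _ 16) => //.
set M := \matrix_(i, k) _.
have -> : M = mx4 [:: [:: 2; 0; 0; 0]; [:: 0; 2; 0; 0]; [:: 0; 0; 2; 0]; [:: 0; 0; 0; 2]].
  apply/matrixP => i k; rewrite !mxE.
  by case: (ord4_cases i) => ->; case: (ord4_cases k) => ->;
    expand_polar; rewrite !mxE /=; ring.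
by rewrite det_mx4E; ring.
Qed.

Lemma not_degen_6B_4A : ~ degen R L6B L4A.
Proof.
apply: (@not_degen_4A (nth 0 [:: e1; e0; e0; e0]) (nth 0 [:: e1; e1; e2; e3]) _ 16) => //.
set M := \matrix_(i, k) _.
have -> : M = mx4 [:: [:: 2; 0; 0; 0]; [:: 0; 2; 0; 0]; [:: 0; 0; 2; 0]; [:: 0; 0; 0; 2]].
  apply/matrixP => i k; rewrite !mxE.
  by case: (ord4_cases i) => ->; case: (ord4_cases k) => ->;
    expand_polar; rewrite !mxE /=; ring.
by rewrite det_mx4E; ring.
Qed.

Lemma not_degen_7B_4A : ~ degen R L7B L4A.
Proof.
apply: (@not_degen_4A (nth 0 [:: e0; e0; e0; e0]) (nth 0 [:: e1; e0; e3; e2]) _ 4) => //.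
set M := \matrix_(i, k) _.
have -> : M = mx4 [:: [:: 2; 0; 0; 0]; [:: 0; 2; 0; 0]; [:: 0; 0; 1; 0]; [:: 0; 0; 0; 1]].
  apply/matrixP => i k; rewrite !mxE.
  by case: (ord4_cases i) => ->; case: (ord4_cases k) => ->;
    expand_polar; rewrite !mxE /=; ring.
by rewrite det_mx4E; ring.
Qed.

(** * Hessian determinants of restrictions to a hyperplane *)

Lemma hess3_4D b0 b1 b2 x : hess3 (@cubic_polar R L4D) b0 b1 b2 x =
  2 * minor3 b0 b1 b2 ^+ 2 * (x o0 0 * x o1 0 * x o2 0).
Proof. by rewrite /hess3 /minor3 /det3; expand_polar; coords_ring. Qed.

Lemma hess3_5A b0 b1 b2 x : hess3 (@cubic_polar R L5A) b0 b1 b2 x =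
  - 8 * minor3 b0 b1 b2 ^+ 2 * x o1 0 ^+ 3.
Proof. by rewrite /hess3 /minor3 /det3; expand_polar; coords_ring. Qed.

Lemma hess3_4B b0 b1 b2 x : hess3 (@cubic_polar R L4B) b0 b1 b2 x =
  24 * minor3 b0 b1 b2 ^+ 2 * (x o0 0 * x o1 0 ^+ 2).
Proof. by rewrite /hess3 /minor3 /det3; expand_polar; coords_ring. Qed.

Lemma hess3Z (T : vec -> vec -> vec -> K) k b0 b1 b2 x :
  hess3 (fun a b c => k * T a b c) b0 b1 b2 x = k ^+ 3 * hess3 T b0 b1 b2 x.
Proof. by rewrite /hess3 /det3; ring. Qed.

Lemma hess3_orbit l u (g : 'M[K]_4) k b0 b1 b2 x :
    (forall a b c, polar u a b c = k * cubic_polar l (g *m a) (g *m b) (g *m c)) ->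
  hess3 (polar u) b0 b1 b2 x =
    k ^+ 3 * hess3 (@cubic_polar R l) (g *m b0) (g *m b1) (g *m b2) (g *m x).
Proof. by move=> h; rewrite -hess3Z /hess3 !h. Qed.

Lemma hess3_cubic l b0 b1 b2 x :
  hess3 (polar (cubic R l)) b0 b1 b2 x = hess3 (@cubic_polar R l) b0 b1 b2 x.
Proof. by rewrite /hess3 !polar_cubic. Qed.

Lemma minor3_basis : minor3 e0 e1 e2 = 1.
Proof. by rewrite /minor3 /det3 !mxE /=; ring. Qed.

Lemma not_degen_5A_4D : ~ degen R L5A L4D.
Proof.
(* This vanishes when the cubic and its Hessian are proportional. At [e1] the form 5A is zero while
   its Hessian is not. *)
pose P (T : vec -> vec -> vec -> K) (H : vec -> K) p q := T p p p * H q - T q q q * H p.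
have P0 k m b0 b1 b2 p q : P (fun x y z => k * cubic_polar L4D x y z)
    (fun x => m * hess3 (@cubic_polar R L4D) b0 b1 b2 x) p q = 0.
  by rewrite /P !hess3_4D; move: (minor3 _ _ _) => d; expand_polar; coords_ring.
apply: (not_degen (P := fun w => P (polar w) (hess3 (polar w) e0 e1 e2) e1 (e0 + e1))
  (is_cubic_cubic _ _)).
- by rewrite /P; form_fun_tac.
- by move=> u /polar_orbit[g [k h]]; rewrite /P !(hess3_orbit _ _ _ _ h) !h; apply: P0.
suff -> : P (polar (cubic R L5A)) (hess3 (polar (cubic R L5A)) e0 e1 e2) e1 (e0 + e1) = 48.
  by rewrite pnatr_eq0.
by rewrite /P !hess3_cubic !hess3_5A minor3_basis !polar_cubic;
  expand_polar; rewrite !mxE /=; ring.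
Qed.

(* Twice the coefficients of the binary cubic [fun s t => F (s *: p + t *: q)]. *)
Definition pencil_coefs (F : vec -> K) p q : K * K * K * K :=
  (2 * F p, F (p + q) - F (p - q) - 2 * F q, F (p + q) + F (p - q) - 2 * F p, 2 * F q).

Definition discr (c : K * K * K * K) : K :=
  let: (c0, c1, c2, c3) := c in
  c1 * c1 * c2 * c2 - 4 * (c0 * c2 * c2 * c2) - 4 * (c1 * c1 * c1 * c3)
  + 18 * (c0 * c1 * c2 * c3) - 27 * (c0 * c0 * c3 * c3).

(* Bezout's determinantal form of the resultant of two binary cubics. *)
Definition bezout (a b : K * K * K * K) : K :=
  let: (a0, a1, a2, a3) := a in let: (b0, b1, b2, b3) := b in
  let m01 := a0 * b1 - a1 * b0 in let m02 := a0 * b2 - a2 * b0 in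
  let m03 := a0 * b3 - a3 * b0 in let m12 := a1 * b2 - a2 * b1 in
  let m13 := a1 * b3 - a3 * b1 in let m23 := a2 * b3 - a3 * b2 in
  det3 m01 m02 m03 m02 (m03 + m12) m13 m03 m13 m23.

Lemma pencil_coefs_mulmx (F G : vec -> K) (g : 'M[K]_4) p q :
  (forall x, F x = G (g *m x)) ->
  pencil_coefs F p q = pencil_coefs G (g *m p) (g *m q).
Proof. by move=> FG; rewrite /pencil_coefs !FG mulmxBr mulmxDr. Qed.

Lemma form_fun_discr d (F : {mpoly K[4]} -> vec -> K) p q :
    (forall x, form_fun d (fun w => F w x)) ->
  form_fun (d + d + d + d) (fun w => discr (pencil_coefs (F w) p q)).
Proof.
move=> hF; rewrite /discr /pencil_coefs /=.
by repeat first [exact: hF | apply: form_funB | apply: form_funD | apply: form_funZ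
  | apply: form_funM].
Qed.

Lemma form_fun_bezout d e (F H : {mpoly K[4]} -> vec -> K) p q :
    (forall x, form_fun d (fun w => F w x)) -> (forall x, form_fun e (fun w => H w x)) ->
  form_fun (d + e + (d + e + (d + e)))
    (fun w => bezout (pencil_coefs (F w) p q) (pencil_coefs (H w) p q)).
Proof.
move=> hF hH; rewrite /bezout /det3 /pencil_coefs /=.
by repeat first [exact: hF | exact: hH | apply: form_funB | apply: form_funD
  | apply: form_funZ | apply: form_funM].
Qed.

Lemma not_degen_4D_4B : ~ degen R L4D L4B.
Proof.
pose P F p q := discr (pencil_coefs F p q).
have P0 k b0 b1 b2 p q : P (fun x => k * hess3 (@cubic_polar R L4B) b0 b1 b2 x) p q = 0.
  rewrite /P /pencil_coefs !hess3_4B !mxE; move: (minor3 _ _ _) => d.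
  by rewrite /discr /=; coords_ring.
apply: (not_degen (P := fun w => P (hess3 (polar w) e0 e1 e2) (e1 + e2) (e0 + e2))
  (is_cubic_cubic _ _)).
- exact: form_fun_discr (form_fun_hess3 _ _ _).
- move=> u /polar_orbit[g [k h]].
  rewrite /P (pencil_coefs_mulmx (G := fun x => k ^+ 3 *
    hess3 (@cubic_polar R L4B) (g *m e0) (g *m e1) (g *m e2) x) (g := g)).
    exact: P0.
  by move=> x; apply: hess3_orbit.
(* On this line x1 x2 x3 restricts to s t (s + t), which has distinct roots. *)
suff -> : P (hess3 (polar (cubic R L4D)) e0 e1 e2) (e1 + e2) (e0 + e2) = 256%:R.
  by rewrite pnatr_eq0.
rewrite /P /pencil_coefs !hess3_cubic !hess3_4D minor3_basis !mxE /discr /=; ring.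
Qed.

(** The conditions on [f] and [h] are the parallelogram law of a quadratic form, so both pencils are
    products of the linear form [l] with binary quadratics. *)
Lemma bezout_common_factor (F f h l : vec -> K) (H : vec -> K) p q :
    (forall x, F x = l x * f x) -> (forall x, H x = l x * h x) ->
    l (p + q) = l p + l q -> l (p - q) = l p - l q ->
    f (p + q) + f (p - q) = 2 * (f p + f q) -> h (p + q) + h (p - q) = 2 * (h p + h q) ->
  bezout (pencil_coefs F p q) (pencil_coefs H p q) = 0.
Proof.
move=> Ff Hh lD lB fD hD.
have fB : f (p - q) = 2 * (f p + f q) - f (p + q) by rewrite -fD addrAC subrr add0r.
have hB : h (p - q) = 2 * (h p + h q) - h (p + q) by rewrite -hD addrAC subrr add0r.
rewrite /pencil_coefs !Ff !Hh lD lB fB hB /bezout /det3.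
move: (l p) (l q) (f p) (f q) (f (p + q)) (h p) (h q) (h (p + q)) => *.
ring.
Qed.

Definition dotp x y : K :=
  x o0 0 * y o0 0 + x o1 0 * y o1 0 + x o2 0 * y o2 0 + x o3 0 * y o3 0.

(* The factor of [l] in the determinant of the 3 x 3 matrix l Q + u v^T + v u^T; here
   [w] is the cross product of u = (l0, l1, l2) and v. *)
Definition cofactor3 (l q00 q01 q02 q11 q12 q22 l0 l1 l2 v0 v1 v2 : K) : K :=
  let w0 := l1 * v2 - l2 * v1 in let w1 := l2 * v0 - l0 * v2 in
  let w2 := l0 * v1 - l1 * v0 in
  let a00 := q11 * q22 - q12 ^+ 2 in let a01 := q02 * q12 - q01 * q22 in
  let a02 := q01 * q12 - q02 * q11 in let a11 := q00 * q22 - q02 ^+ 2 in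
  let a12 := q01 * q02 - q00 * q12 in let a22 := q00 * q11 - q01 ^+ 2 in
  l ^+ 2 * det3 q00 q01 q02 q01 q11 q12 q02 q12 q22
  + 2 * l * (l0 * (a00 * v0 + a01 * v1 + a02 * v2) + l1 * (a01 * v0 + a11 * v1 + a12 * v2)
             + l2 * (a02 * v0 + a12 * v1 + a22 * v2))
  - (w0 * (q00 * w0 + q01 * w1 + q02 * w2) + w1 * (q01 * w0 + q11 * w1 + q12 * w2)
     + w2 * (q02 * w0 + q12 * w1 + q22 * w2)).

Lemma det3_rank2_update (l q00 q01 q02 q11 q12 q22 l0 l1 l2 v0 v1 v2 : K) :
  det3 (l * q00 + l0 * v0 + l0 * v0) (l * q01 + l0 * v1 + l1 * v0) (l * q02 + l0 * v2 + l2 * v0)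
    (l * q01 + l1 * v0 + l0 * v1) (l * q11 + l1 * v1 + l1 * v1) (l * q12 + l1 * v2 + l2 * v1)
    (l * q02 + l2 * v0 + l0 * v2) (l * q12 + l2 * v1 + l1 * v2) (l * q22 + l2 * v2 + l2 * v2) =
  l * cofactor3 l q00 q01 q02 q11 q12 q22 l0 l1 l2 v0 v1 v2.
Proof. by rewrite /cofactor3 /det3; ring. Qed.

(** [cofactor3] is a quadratic form in l and v jointly. *)
Lemma cofactor3_parallelogram (l m q00 q01 q02 q11 q12 q22 l0 l1 l2 v0 v1 v2 w0 w1 w2 : K) :
  let C := fun l => cofactor3 l q00 q01 q02 q11 q12 q22 l0 l1 l2 in
  C (l + m) (v0 + w0) (v1 + w1) (v2 + w2) + C (l - m) (v0 - w0) (v1 - w1) (v2 - w2) =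
  2 * (C l v0 v1 v2 + C m w0 w1 w2).
Proof. by rewrite /cofactor3 /det3; ring. Qed.

Lemma dotpDl x y z : dotp (x + y) z = dotp x z + dotp y z.
Proof. by rewrite /dotp !mxE; ring. Qed.

Lemma dotpBl x y z : dotp (x - y) z = dotp x z - dotp y z.
Proof. by rewrite /dotp !mxE; ring. Qed.

Lemma dotp_parallelogram x y :
  dotp (x + y) (x + y) + dotp (x - y) (x - y) = 2 * (dotp x x + dotp y y).
Proof. by rewrite /dotp !mxE; ring. Qed.

Lemma dotpC x y : dotp x y = dotp y x.
Proof. by rewrite /dotp; coords_ring. Qed.

Lemma cubic_polar_6A x y z : cubic_polar L6A x y z =
  2 * (x o0 0 * dotp y z + y o0 0 * dotp x z + z o0 0 * dotp x y).
Proof. by rewrite /dotp; expand_polar; coords_ring. Qed.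

Lemma hess3_6A b0 b1 b2 x : hess3 (@cubic_polar R L6A) b0 b1 b2 x =
  x o0 0 * (8 * cofactor3 (x o0 0) (dotp b0 b0) (dotp b0 b1) (dotp b0 b2) (dotp b1 b1)
    (dotp b1 b2) (dotp b2 b2) (b0 o0 0) (b1 o0 0) (b2 o0 0)
    (dotp x b0) (dotp x b1) (dotp x b2)).
Proof.
rewrite mulrCA -det3_rank2_update /hess3 !cubic_polar_6A.
by rewrite (dotpC b1 b0) (dotpC b2 b0) (dotpC b2 b1) /det3; ring.
Qed.

Lemma not_degen_4B_6A : ~ degen R L4B L6A.
Proof.
pose P F H p q := bezout (pencil_coefs F p q) (pencil_coefs H p q).
have P0 k m b0 b1 b2 p q : P (fun x => k * cubic_polar L6A x x x)
    (fun x => m * hess3 (@cubic_polar R L6A) b0 b1 b2 x) p q = 0.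
  apply: (bezout_common_factor (l := fun x => x o0 0) (f := fun x => k * (6 * dotp x x))
    (h := fun x => m * (8 * cofactor3 (x o0 0) (dotp b0 b0) (dotp b0 b1) (dotp b0 b2)
    (dotp b1 b1) (dotp b1 b2) (dotp b2 b2) (b0 o0 0) (b1 o0 0) (b2 o0 0)
    (dotp x b0) (dotp x b1) (dotp x b2)))).
  - by move=> x; rewrite cubic_polar_6A; ring.
  - by move=> x; rewrite hess3_6A; ring.
  - by rewrite mxE.
  - by rewrite !mxE.
  - by rewrite -!mulrDr dotp_parallelogram; ring.
  - by rewrite -!mulrDr !dotpBl !dotpDl !mxE cofactor3_parallelogram; ring.
apply: (not_degen (P := fun w => P (fun x => polar w x x x) (hess3 (polar w) e0 e1 e2)
  e0 (e1 + e2)) (is_cubic_cubic _ _)).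
- apply: (form_fun_bezout (F := fun w x => polar w x x x)
    (H := fun w x => hess3 (polar w) e0 e1 e2 x)) => x.
    exact: form_fun_polar.
  exact: form_fun_hess3.
- move=> u /polar_orbit[g [k h]].
  rewrite /P (pencil_coefs_mulmx (F := fun x => polar u x x x)
    (G := fun x => k * cubic_polar L6A x x x) (g := g)); last first.
    by move=> x; apply: h.
  rewrite (pencil_coefs_mulmx (F := hess3 (polar u) e0 e1 e2) (G := fun x => k ^+ 3 *
    hess3 (@cubic_polar R L6A) (g *m e0) (g *m e1) (g *m e2) x) (g := g)).
    exact: P0.
  by move=> x; apply: hess3_orbit.
have cF : pencil_coefs (fun x => polar (cubic R L4B) x x x) e0 (e1 + e2) = (-12, 0, 0, 12).
  by rewrite /pencil_coefs !polar_cubic;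
    expand_polar; rewrite !mxE /=; congr (_, _, _, _); ring.
have cH : pencil_coefs (hess3 (polar (cubic R L4B)) e0 e1 e2) e0 (e1 + e2) = (0, 0, 48, 0).
  rewrite /pencil_coefs !hess3_cubic !hess3_4B minor3_basis !mxE /=.
  by congr (_, _, _, _); ring.
suff -> : P (fun x => polar (cubic R L4B) x x x) (hess3 (polar (cubic R L4B)) e0 e1 e2)
    e0 (e1 + e2) = (12 * 48) ^+ 3.
  by rewrite expf_neq0 // mulf_neq0 // pnatr_eq0.
by rewrite /P cF cH /bezout /det3; ring.
Qed.

(** * Full Hessian determinants *)

Lemma hess4_orbit l (M : vec -> 'M[K]_4) u (g : 'M[K]_4) k x :
    (forall a b c, cubic_polar l a b c = \sum_i \sum_j b i 0 * M a i j * c j 0) ->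
    (forall a b c, polar u a b c = k * cubic_polar l (g *m a) (g *m b) (g *m c)) ->
  hess4 u x = (k ^+ 4 * \det g ^+ 2) * \det (M (g *m x)).
Proof.
move=> hM hu; rewrite /hess4.
have -> : \matrix_(i, j) polar u x (delta_mx i 0) (delta_mx j 0) =
    k *: (g^T *m M (g *m x) *m g).
  apply/matrixP => i j; rewrite mxE hu hM mxE; congr (_ * _).
  rewrite exchange_big [RHS]mxE; apply: eq_bigr => m _.
  rewrite [(g^T *m _) i m]mxE mulr_suml; apply: eq_bigr => n _.
  by rewrite -!colE !mxE.
by rewrite detZ !det_mulmx det_tr; ring.
Qed.

Lemma hess4_cubic l (M : vec -> 'M[K]_4) x :
    (forall a b c, cubic_polar l a b c = \sum_i \sum_j b i 0 * M a i j * c j 0) ->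
  hess4 (cubic R l) x = \det (M x).
Proof.
move=> hM; rewrite (hess4_orbit (g := 1%:M) (k := 1) _ hM).
  by rewrite det1 mul1mx !expr1n !mul1r.
by move=> a b c; rewrite !mul1mx mul1r polar_cubic.
Qed.

Ltac hessian_entries :=
  rewrite !big_ord4 !mxE /=; expand_polar; coords_ring.

Lemma hessian_6B a b c :
  let M x := mx4 [:: [:: 0; 2 * x o1 0; 2 * x o2 0; 2 * x o3 0];
    [:: 2 * x o1 0; 2 * x o0 0; 0; 0];
    [:: 2 * x o2 0; 0; 2 * x o0 0; 0]; [:: 2 * x o3 0; 0; 0; 2 * x o0 0]] in
  cubic_polar L6B a b c = \sum_i \sum_j b i 0 * M a i j * c j 0.
Proof. by move=> M; hessian_entries. Qed.

Lemma hessian_6C a b c :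
  let M x := mx4 [:: [:: 0; 2 * x o1 0; 0; 0]; [:: 2 * x o1 0; 2 * x o0 0; 0; 0];
    [:: 0; 0; 0; 2 * x o3 0]; [:: 0; 0; 2 * x o3 0; 2 * x o2 0]] in
  cubic_polar L6C a b c = \sum_i \sum_j b i 0 * M a i j * c j 0.
Proof. by move=> M; hessian_entries. Qed.

Lemma hessian_7A a b c :
  let M x := mx4 [:: [:: 2 * x o1 0; 2 * x o0 0; 2 * x o2 0; 2 * x o3 0];
    [:: 2 * x o0 0; 0; 0; 0];
    [:: 2 * x o2 0; 0; 2 * x o0 0; 0]; [:: 2 * x o3 0; 0; 0; 2 * x o0 0]] in
  cubic_polar L7A a b c = \sum_i \sum_j b i 0 * M a i j * c j 0.
Proof. by move=> M; hessian_entries. Qed.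

Lemma hessian_7B a b c :
  let M x := mx4 [:: [:: 2 * x o1 0; 2 * x o0 0; x o3 0; x o2 0]; [:: 2 * x o0 0; 0; 0; 0];
    [:: x o3 0; 0; 6 * x o2 0; x o0 0]; [:: x o2 0; 0; x o0 0; 0]] in
  cubic_polar L7B a b c = \sum_i \sum_j b i 0 * M a i j * c j 0.
Proof. by move=> M; hessian_entries. Qed.

Lemma hess4_6B x : hess4 (cubic R L6B) x =
  - 16 * x o0 0 ^+ 2 * (x o1 0 ^+ 2 + x o2 0 ^+ 2 + x o3 0 ^+ 2).
Proof. by rewrite (hess4_cubic _ hessian_6B) det_mx4E; coords_ring. Qed.

Lemma hess4_6C x : hess4 (cubic R L6C) x = 16 * (x o1 0 * x o3 0) ^+ 2.
Proof. by rewrite (hess4_cubic _ hessian_6C) det_mx4E; coords_ring. Qed.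

Lemma hess4_7A x : hess4 (cubic R L7A) x = - 16 * x o0 0 ^+ 4.
Proof. by rewrite (hess4_cubic _ hessian_7A) det_mx4E; coords_ring. Qed.

Lemma hess4_7B x : hess4 (cubic R L7B) x = 4 * x o0 0 ^+ 4.
Proof. by rewrite (hess4_cubic _ hessian_7B) det_mx4E; coords_ring. Qed.

(* Vanishes when [F] is a fourth power of a linear form: with a = l p and b = l q,
   (a + b)^4 + (a - b)^4 - 2 a^4 - 2 b^4 = 12 a^2 b^2. *)
Definition quartic_test (F : vec -> K) p q : K :=
  let s := F (p + q) + F (p - q) - 2 * F p - 2 * F q in s * s - 144%:R * (F p * F q).

Lemma form_fun_quartic_test d (F : {mpoly K[4]} -> vec -> K) p q :
  (forall x, form_fun d (fun w => F w x)) -> form_fun (d + d) (fun w => quartic_test (F w) p q).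
Proof.
move=> hF; rewrite /quartic_test /=.
by repeat first [exact: hF | apply: form_funB | apply: form_funD | apply: form_funZ
  | apply: form_funM].
Qed.

Lemma quartic_test_power4 (F : vec -> K) (g : 'M[K]_4) m p q :
  (forall x, F x = m * (g *m x) o0 0 ^+ 4) -> quartic_test F p q = 0.
Proof.
move=> Fg; rewrite /quartic_test /= !Fg mulmxBr mulmxDr.
by move: (g *m p) (g *m q) => y z; rewrite !mxE; ring.
Qed.

Lemma not_degen_quartic_test (r c : label) (m : K) p q (n : nat) (M : vec -> 'M[K]_4) :
    (forall a b c', cubic_polar c a b c' = \sum_i \sum_j b i 0 * M a i j * c' j 0) ->
    (forall x, hess4 (cubic R c) x = m * x o0 0 ^+ 4) -> (n != 0)%N ->
    quartic_test (hess4 (cubic R r)) p q = n%:R ->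
  ~ degen R r c.
Proof.
move=> hM hc n0 e.
apply: (not_degen (P := fun w => quartic_test (hess4 w) p q) (is_cubic_cubic _ _)).
- exact: form_fun_quartic_test (@form_fun_hess4 R).
- move=> u /polar_orbit[g [k h]].
  apply: (@quartic_test_power4 _ g (k ^+ 4 * \det g ^+ 2 * m)) => x.
  by rewrite (hess4_orbit _ hM h) -[RHS]mulrA -hc (hess4_cubic _ hM).
by rewrite e pnatr_eq0.
Qed.

Lemma not_degen_6B_7A : ~ degen R L6B L7A.
Proof.
(* On this line the Hessian is -16 s^2 t^2: it vanishes at both points, and the test gives
   (-32)^2. *)
apply: (@not_degen_quartic_test _ _ (- 16) e0 e1 1024 _ hessian_7A hess4_7A) => //.
by rewrite /quartic_test !hess4_6B !mxE /=; ring.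
Qed.

Lemma not_degen_6B_7B : ~ degen R L6B L7B.
Proof.
apply: (@not_degen_quartic_test _ _ 4 e0 e1 1024 _ hessian_7B hess4_7B) => //.
by rewrite /quartic_test !hess4_6B !mxE /=; ring.
Qed.

Lemma not_degen_6C_7B : ~ degen R L6C L7B.
Proof.
apply: (@not_degen_quartic_test _ _ 4 e1 e3 1024 _ hessian_7B hess4_7B) => //.
by rewrite /quartic_test !hess4_6C !mxE /=; ring.
Qed.

Lemma cubic_polar_6B_diag x : cubic_polar L6B x x x =
  6 * (x o0 0 * (x o1 0 ^+ 2 + x o2 0 ^+ 2 + x o3 0 ^+ 2)).
Proof. by expand_polar; coords_ring. Qed.

Lemma not_degen_7A_6B : ~ degen R L7A L6B.
Proof.
(* If H = l F with l linear, then l (p + q) + l (p - q) = 2 l p; [P] is this relation for H / F with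
   denominators cleared. *)
pose P (F H : vec -> K) p q :=
  H (p + q) * F (p - q) * F p + H (p - q) * F (p + q) * F p - 2 * (H p * F (p + q) * F (p - q)).
have PF d e (F H : {mpoly K[4]} -> vec -> K) p q : (forall x, form_fun d (fun w => F w x)) ->
    (forall x, form_fun e (fun w => H w x)) ->
    form_fun (e + d + d) (fun w => P (F w) (H w) p q).
  move=> hF hH; rewrite /P.
  by repeat first [exact: hF | exact: hH | apply: form_funB | apply: form_funD
    | apply: form_funZ | apply: form_funM].
have P00 F H p q : (forall x, F x = 0) -> P F H p q = 0.
  by move=> F0; rewrite /P !F0; ring.
have P0 F H (l : vec -> K) m p q : (forall x, m * H x = l x * F x) -> m != 0 ->
    l (p + q) = l p + l q -> l (p - q) = l p - l q -> P F H p q = 0.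
  move=> HF m0 lD lB; apply: (mulfI m0); rewrite mulr0.
  transitivity (m * H (p + q) * F (p - q) * F p + m * H (p - q) * F (p + q) * F p
    - 2 * (m * H p * F (p + q) * F (p - q))); first by rewrite /P; ring.
  by rewrite !HF lD lB; ring.
apply: (not_degen (P := fun w => P (fun x => polar w x x x) (hess4 w) e0 e1)
  (is_cubic_cubic _ _)).
- by apply: (PF 1 4 (fun w x => polar w x x x)) => x;
  [apply: form_fun_polar | apply: form_fun_hess4].
- move=> u /polar_orbit[g [k h]]; have [k0|k0] := eqVneq k 0.
    by apply: P00 => x; rewrite h k0 mul0r.
  (* With y = g x, D = k^4 det(g)^2 and q = y2^2 + y3^2 + y4^2, the cubic is 6 k y1 q and its
     Hessian -16 D y1^2 q, so 3 k H = (-8 D y1) F. *)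
  apply: (P0 _ _ (fun x => - 8 * (k ^+ 4 * \det g ^+ 2) * (g *m x) o0 0) (3 * k)).
  + move=> x /=; rewrite (hess4_orbit _ hessian_6B h) -(hess4_cubic _ hessian_6B) hess4_6B h
    cubic_polar_6B_diag.
    by move: (g *m x) (\det g) => y d; ring.
  + by rewrite mulf_neq0 // pnatr_eq0.
  + by rewrite /= mulmxDr; move: (g *m e0) (g *m e1) => y z; rewrite mxE; ring.
  + by rewrite /= mulmxBr; move: (g *m e0) (g *m e1) => y z; rewrite !mxE; ring.
suff -> : P (fun x => polar (cubic R L7A) x x x) (hess4 (cubic R L7A)) e0 e1 = - 1152%:R.
  by rewrite oppr_eq0 pnatr_eq0.
by rewrite /P !hess4_7A !polar_cubic; expand_polar; rewrite !mxE /=; ring.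
Qed.

End NonContainments.

(** * The order generated by the covering relations *)

Definition covered (c : label) : seq label :=
  match c with
  | L1A => [::]
  | L3A => [:: L1A]
  | L2A => [:: L3A]
  | L4D | L5A => [:: L2A]
  | L4B => [:: L5A]
  | L4C => [:: L4D; L5A]
  | L4A => [:: L4B; L4C]
  | L6B | L7A => [:: L4C]
  | L7B => [:: L4B; L4C]
  | L6A => [:: L6B; L7A]
  | L6C => [:: L4A; L7B]
  end.

Fixpoint below (n : nat) (c : label) : seq label :=
  c :: if n is m.+1 then flatten [seq below m d | d <- covered c] else [::].

Lemma degen_covered (R : realType) c r : r \in covered c -> degen R r c.
Proof.
case: c; case: r => // _; [
  exact: degen_3A_2A | exact: degen_1A_3A | exact: degen_4B_4A | exact: degen_4C_4A |
  exact: degen_5A_4B | exact: degen_4D_4C | exact: degen_5A_4C | exact: degen_2A_4D |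
  exact: degen_2A_5A | exact: degen_6B_6A | exact: degen_7A_6A | exact: degen_4C_6B |
  exact: degen_4A_6C | exact: degen_7B_6C | exact: degen_4C_7A | exact: degen_4B_7B |
  exact: degen_4C_7B].
Qed.

Lemma degen_below (R : realType) n c r : r \in below n c -> degen R r c.
Proof.
elim: n c => [|n IH] c /=; first by rewrite inE => /eqP->.
rewrite inE => /orP[/eqP->//|/flatten_mapP[d /(@degen_covered R) dc /IH rd]].
exact: degen_trans rd dc.
Qed.

Definition minimal_nondegenerations : seq (label * label) :=
  [:: (L3A, L1A); (L2A, L3A); (L4D, L2A); (L5A, L2A); (L6B, L4A); (L7A, L4A); (L7B, L4A);
      (L5A, L4D); (L4D, L4B); (L4B, L6A); (L6B, L7A); (L6B, L7B); (L6C, L7B); (L7A, L6B)].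

Lemma not_degen_minimal (R : realType) b : b \in minimal_nondegenerations -> ~ degen R b.1 b.2.
Proof.
case: b => -[] [] // _; [
  exact: not_degen_2A_3A | exact: not_degen_3A_1A | exact: not_degen_4B_6A |
  exact: not_degen_4D_2A | exact: not_degen_4D_4B | exact: not_degen_5A_2A |
  exact: not_degen_5A_4D | exact: not_degen_6B_4A | exact: not_degen_6B_7A |
  exact: not_degen_6B_7B | exact: not_degen_6C_7B | exact: not_degen_7A_4A |
  exact: not_degen_7A_6B | exact: not_degen_7B_4A].
Qed.

Lemma degen_in (R : realType) n r s :
  all (fun c => r \in below n c) s -> {in s, forall c, degen R r c}.
Proof. by move=> /allP h c /h; apply: degen_below. Qed.

(** If b.1 <= r and c <= b.2, then r <= c would give b.1 <= b.2, which is excluded. *)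
Lemma not_degen_in (R : realType) n r s :
    all (fun c => has (fun b => (b.1 \in below n r) && (c \in below n b.2))
      minimal_nondegenerations) s ->
  {in s, forall c, ~ degen R r c}.
Proof.
move=> /allP h c /h /hasP[b /(@not_degen_minimal R) nb /andP[]].
move=> /(@degen_below R) br /(@degen_below R) cb rc.
by apply: nb; apply: degen_trans br (degen_trans rc cb).
Qed.

Theorem mainTheorem1 (R : realType) :
  (forall r : label, degen R r r) /\
  (* (a) containments *)
  ((forall c : label, degen R L1A c) /\
   {in [:: L4A; L4B; L4C; L4D; L5A; L6A; L6B; L6C; L7A; L7B],
     forall c, degen R L2A c} /\
   {in [:: L2A; L4A; L4B; L4C; L4D; L5A; L6A; L6B; L6C; L7A; L7B],
     forall c, degen R L3A c} /\
   degen R L4A L6C /\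
   {in [:: L4A; L6C; L7B], forall c, degen R L4B c} /\
   {in [:: L4A; L6A; L6B; L6C; L7A; L7B], forall c, degen R L4C c} /\
   {in [:: L4A; L4C; L6A; L6B; L6C; L7A; L7B], forall c, degen R L4D c} /\
   {in [:: L4A; L4B; L4C; L6A; L6B; L6C; L7A; L7B],
     forall c, degen R L5A c} /\
   degen R L6B L6A /\
   degen R L7A L6A /\
   degen R L7B L6C) /\
  (* (b) non-containments *)
  ({in [:: L1A; L3A], forall c, ~ degen R L2A c} /\
   ~ degen R L3A L1A /\
   {in [:: L1A; L2A; L3A; L4B; L4C; L4D; L5A; L6B; L7A],
     forall c, ~ degen R L4A c} /\
   {in [:: L1A; L2A; L3A; L4C; L4D; L5A], forall c, ~ degen R L4B c} /\
   {in [:: L1A; L2A; L3A; L4B; L4D; L5A], forall c, ~ degen R L4C c} /\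
   {in [:: L1A; L2A; L3A; L5A], forall c, ~ degen R L4D c} /\
   {in [:: L1A; L2A; L3A; L4D], forall c, ~ degen R L5A c} /\
   {in [:: L1A; L2A; L3A; L4A; L4B; L4C; L4D; L5A; L6B; L7A; L7B],
     forall c, ~ degen R L6A c} /\
   {in [:: L1A; L2A; L3A; L4A; L4B; L4C; L4D; L5A; L7A],
     forall c, ~ degen R L6B c} /\
   (forall c : label, c <> L6C -> ~ degen R L6C c) /\
   {in [:: L1A; L2A; L3A; L4A; L4B; L4C; L4D; L5A; L6B],
     forall c, ~ degen R L7A c} /\
   {in [:: L1A; L2A; L3A; L4A; L4B; L4C; L4D; L5A; L6A; L6B; L7A],
     forall c, ~ degen R L7B c}).
Proof.
(* The longest chains have six covers, such as 1A < 3A < 2A < 5A < 4B < 4A < 6C. *)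
have le6 := @degen_below R 6; have le6_in := @degen_in R 6.
have not_in := @not_degen_in R 6.
split; first by move=> r.
split.
  split; first by move=> c; apply: le6; case: c.
  by do 9 (split; first by [apply: le6_in | apply: le6]); apply: le6.
split; first exact: not_in.
split; first by apply: (not_in L3A [:: L1A]).
do 7 (split; first exact: not_in).
split; last by split; apply: not_in.
move=> c c6C.
apply: (not_in L6C [:: L1A; L2A; L3A; L4A; L4B; L4C; L4D; L5A; L6A; L6B; L7A; L7B]) => //.
by case: c c6C.
Qed.
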